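(* Suppose the following hold. (1) The sets $\mathbb{U}$, $\mathbb{W}$, $\mathbb{Z}$, $\mathbb{X}_f$ are closed, convex, and contain the origin; $\mathbb{U}$ and $\mathbb{W}$ are bounded; and $\mathbb{W}$ contains the origin in its interior. (2) $Q,R,P\succeq 0$. (3) There exists $K_f\in\mathbb{R}^{m\times n}$ such that $P-Q-K_f'RK_f\succeq (A+BK_f)'P(A+BK_f)$; moreover $\mathbb{X}_f$ contains the origin in its interior, and $(x,K_fx)\in\mathbb{Z}$ and $(A+BK_f)x+Gw\in\mathbb{X}_f$ for all $x\in\mathbb{X}_f$ and $w\in\mathbb{W}$. (4) $Q\succ 0$, and either $\mathcal{X}$ is bounded or $\mathbb{X}_f=\mathbb{R}^n$. Then there exist $\lambda\in(0,1)$ and $c,\gamma>0$ such that $$\mathbb{E}_{\mathbb{P}}\left[|\phi_d(k;x,\mathbf{w}_\infty)|^2\right]\le\lambda^k c|x|^2+\gamma\left(\max_{\Sigma\in\mathbb{B}_d}\mathrm{tr}(G'PG\Sigma)\right)$$ for all $k\ge 0$, $x\in\mathcal{X}$, $d\in\mathcal{D}$, and $\mathbb{P}\in\mathcal{P}_d^\infty$.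
   Context: System: $x^+=Ax+Bu+Gw$ with $A\in\mathbb{R}^{n\times n}$, $B\in\mathbb{R}^{n\times m}$, $G\in\mathbb{R}^{n\times q}$, input set $\mathbb{U}\subseteq\mathbb{R}^m$, disturbance set $\mathbb{W}\subseteq\mathbb{R}^q$, state-input constraint set $\mathbb{Z}\subseteq\mathbb{R}^n\times\mathbb{U}$, terminal set $\mathbb{X}_f\subseteq\mathbb{R}^n$, horizon $N\ge 1$. A prime denotes transpose; positive (semi)definite matrices are symmetric. Policies: $\Theta$ is the set of pairs $\theta=(\mathbf{M},\mathbf{v})$ with $\mathbf{v}=(v(0),\dots,v(N-1))\in\mathbb{R}^{Nm}$ and $\mathbf{M}\in\mathbb{R}^{Nm\times Nq}$ having blocks $M(i,j)\in\mathbb{R}^{m\times q}$ ($0\le i,j\le N-1$) with $M(i,j)=0$ for $j\ge i$. Given $x\in\mathbb{R}^n$, $\theta\in\Theta$, $\mathbf{w}=(w(0),\dots,w(N-1))$, put $u(i)=v(i)+\sum_{j=0}^{i-1}M(i,j)w(j)$, $x(0)=x$, $x(i+1)=Ax(i)+Bu(i)+Gw(i)$. $\Pi(x)$ is the set of $\theta\in\Theta$ such that for all $\mathbf{w}\in\mathbb{W}^N$: $(x(k),u(k))\in\mathbb{Z}$ for $k=0,\dots,N-1$ and $x(N)\in\mathbb{X}_f$. Feasible set: $\mathcal{X}=\{x\in\mathbb{R}^n:\Pi(x)\ne\emptyset\}$. Cost: $\ell(x,u)=x'Qx+u'Ru$, $V_f(x)=x'Px$, $J(x,\theta,\mathbf{w})=\sum_{k=0}^{N-1}\ell(x(k),u(k))+V_f(x(N))$.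 Ambiguity: $\mathcal{M}(S)$ is the set of probability distributions with zero mean for which the random variable lies in $S$ with probability one. For $d=(\varepsilon,\widehat\Sigma)$ with $\varepsilon\ge 0$, $\widehat\Sigma\succeq 0$ in $\mathbb{R}^{q\times q}$, let $\mathbb{B}_d=\{\Sigma\succeq 0:\mathrm{tr}(\widehat\Sigma+\Sigma-2(\widehat\Sigma^{1/2}\Sigma\widehat\Sigma^{1/2})^{1/2})\le\varepsilon^2\}$ and $\mathcal{P}_d=\{\mathbb{P}\in\mathcal{M}(\mathbb{W}):\mathbb{E}_{\mathbb{P}}[ww']\in\mathbb{B}_d\}$. $\mathcal{D}$ is the set of all such $d$ for which every $\Sigma\in\mathbb{B}_d$ equals $\mathbb{E}_{\mathbb{P}}[ww']$ for some $\mathbb{P}\in\mathcal{M}(\mathbb{W})$. $\mathcal{P}_d^N$ (resp. $\mathcal{P}_d^\infty$) is the set of distributions of $(w(0),\dots,w(N-1))$ (resp. of $\mathbf{w}_\infty=(w(0),w(1),\dots)$) such that the $w(k)$ are independent and each $w(k)$ has distribution in $\mathcal{P}_d$. Controller: $V_d(x,\theta)=\max_{\mathbb{P}\in\mathcal{P}_d^N}\mathbb{E}_{\mathbb{P}}[J(x,\theta,\mathbf{w})]$, $V_d^0(x)=\min_{\theta\in\Pi(x)}V_d(x,\theta)$, and $\theta_d^0(x)$ is the set of minimizers. For each $d\in\mathcal{D}$, $\kappa_d:\mathcal{X}\to\mathbb{U}$ is a single-valued Borel measurable selection with $\kappa_d(x)\in\{v^0(0):(\mathbf{M}^0,\mathbf{v}^0)\in\theta_d^0(x)\}$.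 $\phi_d(k;x,\mathbf{w}_\infty)$ is the state at time $k$ of the closed-loop system $x^+=Ax+B\kappa_d(x)+Gw$ started at $x$ with disturbance sequence $\mathbf{w}_\infty\in\mathbb{W}^\infty$ (under the hypotheses $\mathcal{X}$ is invariant for this system, so this is well defined for $x\in\mathcal{X}$). *)

(* Defs.v *)
From HB Require Import structures.
From mathcomp Require Export all_boot all_order all_algebra.
From mathcomp Require Export all_classical all_reals all_analysis.
Export Order.TTheory GRing.Theory Num.Theory numFieldNormedType.Exports.

Set Implicit Arguments.
Unset Strict Implicit.
Unset Printing Implicit Defensive.

Local Open Scope classical_set_scope.
Local Open Scope ring_scope.

Section linear_algebra.
Context {R : realType}.

Definition qform {p : nat} (S : 'M[R]_p) (x : 'cV[R]_p) : R :=
  (x^T *m S *m x) 0 0.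

(* The norm that MathComp-Analysis puts on matrices is the max norm; the
   Euclidean one is spelled out here. *)
Definition sqnorm {p : nat} (x : 'cV[R]_p) : R := \sum_i x i 0 ^+ 2.

Definition psd {p : nat} (S : 'M[R]_p) : Prop :=
  S^T = S /\ forall x : 'cV[R]_p, 0 <= qform S x.

Definition pd {p : nat} (S : 'M[R]_p) : Prop :=
  S^T = S /\ forall x : 'cV[R]_p, x != 0 -> 0 < qform S x.

(* The positive semidefinite square root, unique for positive semidefinite S
   (0 when there is none). *)
Definition sqrtmx {p : nat} (S : 'M[R]_p) : 'M[R]_p :=
  xget 0 [set T : 'M[R]_p | psd T /\ T *m T = S].

End linear_algebra.

(* R^p with its Borel sigma-algebra. *)
Notation borelV R p := (g_sigma_algebraType (@open 'cV[R]_p)).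

(* Families (w(i))_{i : I} in R^p; seqV carries the product of the Borel
   sigma-algebras. *)
Definition cylinders (R : realType) (p : nat) (I : Type) :
    set (set (I -> borelV R p)) :=
  [set C | exists i (B : set (borelV R p)),
     measurable B /\ C = (fun w => w i) @^-1` B].
Arguments cylinders : clear implicits.

Notation seqV R p I := (g_sigma_algebraType (cylinders R p I)).

Section coordinates.
Context {R : realType} {p : nat} {I : Type}.

Definition coord (i : I) (w : seqV R p I) : borelV R p := w i.

Lemma measurable_coord (i : I) : measurable_fun setT (coord i).
Proof.
by move=> _ B mB; rewrite setTI; apply: sub_sigma_algebra; exists i, B.
Qed.

HB.instance Definition _ (i : I) :=
  isMeasurableFun.Build _ _ _ _ (coord i) (measurable_coord i).

End coordinates.

Section ambiguity.
Context {R : realType} {q : nat}.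
Implicit Types (P : probability (borelV R q) R) (W : set 'cV[R]_q).

(* A vanishing integral is in particular absolutely convergent here: with the
   conventions of the library, an undefined or divergent one is infinite. *)
Definition zero_mean P : Prop :=
  forall i : 'I_q, ('E_P[fun w => ((w : 'cV[R]_q) i 0)%R] = 0)%E.

Definition zero_mean_laws W : set (probability (borelV R q) R) :=
  [set P : probability (borelV R q) R |
     P (W : set (borelV R q)) = 1%E /\ zero_mean P].

(* E[w w'], finite for the distributions considered, W being bounded. *)
Definition second_moment P : 'M[R]_q :=
  \matrix_(i, j)
    fine ('E_P[fun w => ((w : 'cV[R]_q) i 0 * (w : 'cV[R]_q) j 0)%R])%E.

(* d = (epsilon, hat Sigma) *)
Definition gelbrich_ball (d : R * 'M[R]_q) : set 'M[R]_q :=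
  [set S | psd S /\
     \tr (d.2 + S - 2 *: sqrtmx (sqrtmx d.2 *m S *m sqrtmx d.2)) <= d.1 ^+ 2].

Definition ambiguity_set W (d : R * 'M[R]_q) :
    set (probability (borelV R q) R) :=
  [set P : probability (borelV R q) R |
     zero_mean_laws W P /\ gelbrich_ball d (second_moment P)].

Definition ambiguity_params W : set (R * 'M[R]_q) :=
  [set d | [/\ 0 <= d.1, psd d.2 &
     forall S, gelbrich_ball d S ->
       exists2 P, zero_mean_laws W P & second_moment P = S]].

Definition independent_coords (I : eqType) (P : probability (seqV R q I) R) :
    Prop :=
  forall (s : seq I) (B : I -> set (borelV R q)), uniq s ->
    (forall i, measurable (B i)) ->
    P (\bigcap_(i in [set` s]) (coord i @^-1` B i)) =
    (\prod_(i <- s) P (coord i @^-1` B i))%E.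

Definition ambiguity_laws (I : eqType) W (d : R * 'M[R]_q) :
    set (probability (seqV R q I) R) :=
  [set P : probability (seqV R q I) R |
     independent_coords P /\
     forall i, ambiguity_set W d (distribution P (coord i))].

End ambiguity.

Record mpc_problem (R : realType) (n m q : nat) := MpcProblem {
  dynA : 'M[R]_n;
  dynB : 'M[R]_(n, m);
  dynG : 'M[R]_(n, q);
  inputU : set 'cV[R]_m;
  distW : set 'cV[R]_q;
  consZ : set ('cV[R]_n * 'cV[R]_m);
  consZ_input : forall z, consZ z -> inputU z.2;
  termX : set 'cV[R]_n;
  horizon : nat;
  horizon_gt0 : (0 < horizon)%N;
  costQ : 'M[R]_n;
  costR : 'M[R]_m;
  costP : 'M[R]_n
}.

Section controller.
Context {R : realType} {n m q : nat} (mpc : mpc_problem R n m q).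
Local Notation N := (horizon mpc).

(* gain i j is the block M(i, j) and offset i the block v(i). *)
Record policy := Policy {
  gain : 'I_N -> 'I_N -> 'M[R]_(m, q);
  offset : 'I_N -> 'cV[R]_m
}.

Definition causal (th : policy) : Prop :=
  forall i j : 'I_N, (i <= j)%N -> gain th i j = 0.

Definition input (th : policy) (w : 'I_N -> 'cV[R]_q) (i : 'I_N) : 'cV[R]_m :=
  offset th i + \sum_(j < N | (j < i)%N) gain th i j *m w j.

(* The state x(k) for k <= N; it is frozen at x(N) afterwards. *)
Fixpoint state (x : 'cV[R]_n) (th : policy) (w : 'I_N -> 'cV[R]_q) (k : nat) :
    'cV[R]_n :=
  if k is k'.+1 then
    let xk := state x th w k' in
    if insub k' is Some i
    then dynA mpc *m xk + dynB mpc *m input th w i + dynG mpc *m w i else xk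
  else x.

Definition admissible (x : 'cV[R]_n) : set policy :=
  [set th | causal th /\
     forall w : 'I_N -> 'cV[R]_q, (forall i, distW mpc (w i)) ->
       (forall k : 'I_N, consZ mpc (state x th w k, input th w k)) /\
       termX mpc (state x th w N)].

Definition feasible : set 'cV[R]_n := [set x | admissible x !=set0].

Definition cost (x : 'cV[R]_n) (th : policy) (w : 'I_N -> 'cV[R]_q) : R :=
  \sum_(k < N) (qform (costQ mpc) (state x th w k) +
                qform (costR mpc) (input th w k)) +
  qform (costP mpc) (state x th w N).

(* The supremum is attained for every d in ambiguity_params when distW mpc is
   bounded: the expectation is affine in the covariances of the w(k), which
   range over a compact set. *)
Definition worst_cost (d : R * 'M[R]_q) (x : 'cV[R]_n) (th : policy) : \bar R :=
  ereal_sup [set ('E_P[cost x th])%E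
            | P in @ambiguity_laws R q 'I_N (distW mpc) d].

Definition optimal (d : R * 'M[R]_q) (x : 'cV[R]_n) : set policy :=
  [set th | admissible x th /\
     forall th', admissible x th' ->
       (worst_cost d x th <= worst_cost d x th')%E].

Definition control_law (d : R * 'M[R]_q) (kappa : 'cV[R]_n -> 'cV[R]_m) :
    Prop :=
  [/\ measurable_fun (feasible : set (borelV R n))
        (kappa : borelV R n -> borelV R m),
      forall x, feasible x -> inputU mpc (kappa x) &
      forall x, feasible x ->
        exists2 th, optimal d x th &
          kappa x = offset th (Ordinal (horizon_gt0 mpc))].

(* A control law is only meaningful on the feasible set; its values elsewhere
   are replaced by 0. *)
Fixpoint closed_loop (kappa : 'cV[R]_n -> 'cV[R]_m) (x : 'cV[R]_n)
    (w : nat -> 'cV[R]_q) (k : nat) : 'cV[R]_n :=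
  if k is k'.+1 then
    let xk := closed_loop kappa x w k' in
    let u := if xk \in feasible then kappa xk else 0 in
    dynA mpc *m xk + dynB mpc *m u + dynG mpc *m w k'
  else x.

(* The maximum of tr(G'PG Sigma) over the compact set gelbrich_ball d. *)
Definition max_trace (d : R * 'M[R]_q) : \bar R :=
  ereal_sup [set (\tr ((dynG mpc)^T *m costP mpc *m dynG mpc *m Sg))%:E
            | Sg in gelbrich_ball d].

End controller.

(* Main.v *)
Require Import Defs.
From mathcomp Require Import ring lra zify.
From mathcomp Require Import measurable_realfun.

(** The optimal worst-case cost V of the finite-horizon problem is a stochastic
    Lyapunov function for the closed loop. Let sigma be the maximum of the trace
    over the ambiguity ball. There are constants 0 < l < C, the same for all
    ambiguity parameters, with
      l |x|^2 <= V(x)   and   V(x) <= C |x|^2 + N sigma if x is feasible,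
      E V(A x + B kappa(x) + G v) <= V(x) - l |x|^2 + sigma
    for every feasible x and every v whose law is in the ambiguity set. With
    a = l / C this gives
      E V(x(k+1)) <= (1 - a) E V(x(k)) + (1 + a N) sigma,
    and iterating it yields the bound on E |x(k)|^2.

    Everything rests on one fact. For a fixed policy, states and inputs are
    affine in the disturbances, which are centred and uncorrelated; so the
    expected cost is the cost without disturbances plus a term that depends on
    the gains of the policy and the covariances only ([has_mean_cost]).

    The lower bound on V holds because Q is positive definite. For the upper
    bound, on the terminal set apply the terminal feedback from the start: the
    matrix inequality on P makes the costs telescope ([value_terminal]). Outside
    the terminal set, if there are such points, the feasible set is bounded, so
    V is bounded and |x| is bounded away from 0.

    For the decrease ([value_descent]), once the first disturbance v is known,
    the tail of an optimal policy followed by one step of terminal feedback is a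
    candidate for the successor state. Only its offsets depend on v, hence the
    disturbance part of its expected cost does not; so the supremum over the
    laws of the later disturbances may be taken after the mean over v. Each such
    law, preceded by the law of v, is a law of the whole sequence, against which
    the optimal policy was already tested ([ambiguity_laws_prepend]).

    Means along the closed loop make sense because V is lower semicontinuous:
    its sublevel sets are projections of closed sets, along the admissible
    policies, which are bounded since the inputs are and since 0 is interior to
    the disturbance set ([closed_sublevel]). Finally x(k) is a function of the
    first k disturbances, hence independent of w(k), so that the decrease may be
    integrated one step at a time ([chain_step]). *)

Set Implicit Arguments.
Unset Strict Implicit.
Unset Printing Implicit Defensive.

Local Open Scope classical_set_scope.
Local Open Scope ring_scope.

(** * Limits of matrices, and bounds for quadratic forms *)

Section mx_limits.
Context {R : realType} {T : Type} {F : set_system T} {FF : Filter F}.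

Lemma cvg_mx (a b : nat) (f : T -> 'M[R]_(a, b)) (M : 'M[R]_(a, b)) :
  (forall i j, f t i j @[t --> F] --> M i j) -> f t @[t --> F] --> M.
Proof.
move=> fM A [P MP PA]; rewrite /nbhs/=.
have H : \forall t \near F, forall i j, P i j (f t i j).
  by apply: filter_forall => i; apply: filter_forall => j; apply: fM; exact: MP.
by apply: filterS H => t Pt; apply: PA.
Qed.

Lemma cvg_mx_coord (a b : nat) (f : T -> 'M[R]_(a, b)) (M : 'M[R]_(a, b)) i j :
  f t @[t --> F] --> M -> f t i j @[t --> F] --> M i j.
Proof.
move=> fM; apply: (cvg_comp (fun t => f t) (fun N : 'M[R]_(a, b) => N i j) fM).
exact: (@coord_continuous R a b i j M).
Qed.

Lemma cvg_sum_fin (I : finType) (f : I -> T -> R) (l : I -> R) :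
  (forall i, f i t @[t --> F] --> l i) ->
  (\sum_i f i t) @[t --> F] --> \sum_i l i.
Proof.
move=> fl; apply: cvg_big => [|i _]; last exact: fl.
by move=> x; apply: cvgD; [exact: cvg_fst|exact: cvg_snd].
Qed.

Lemma cvg_sum_mx (a b : nat) (I : finType) (f : I -> T -> 'M[R]_(a, b))
    (l : I -> 'M[R]_(a, b)) :
  (forall i, f i t @[t --> F] --> l i) ->
  (\sum_i f i t) @[t --> F] --> \sum_i l i.
Proof.
move=> fl; apply: cvg_mx => i j; under eq_fun do rewrite summxE.
by rewrite summxE; apply: cvg_sum_fin => k; exact: cvg_mx_coord.
Qed.

Lemma cvg_mulmx (a b c : nat) (f : T -> 'M[R]_(a, b)) (g : T -> 'M[R]_(b, c))
    (M : 'M[R]_(a, b)) (N : 'M[R]_(b, c)) :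
  f t @[t --> F] --> M -> g t @[t --> F] --> N ->
  f t *m g t @[t --> F] --> M *m N.
Proof.
move=> fM gN; apply: cvg_mx => i j.
under eq_fun do rewrite mxE; rewrite mxE.
by apply: cvg_sum_fin => k; apply: cvgM; exact: cvg_mx_coord.
Qed.

Lemma cvg_trmx (a b : nat) (f : T -> 'M[R]_(a, b)) (M : 'M[R]_(a, b)) :
  f t @[t --> F] --> M -> (f t)^T @[t --> F] --> M^T.
Proof.
move=> fM; apply: cvg_mx => i j; under eq_fun do rewrite mxE; rewrite mxE.
exact: cvg_mx_coord.
Qed.

Lemma cvg_mxtrace (a : nat) (f : T -> 'M[R]_a) (M : 'M[R]_a) :
  f t @[t --> F] --> M -> \tr (f t) @[t --> F] --> \tr M.
Proof. by move=> fM; apply: cvg_sum_fin => k; exact: cvg_mx_coord. Qed.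

Lemma cvg_qform (a : nat) (S : 'M[R]_a) (f : T -> 'cV[R]_a) (x : 'cV[R]_a) :
  f t @[t --> F] --> x -> qform S (f t) @[t --> F] --> qform S x.
Proof.
move=> fx; rewrite /qform; apply: cvg_mx_coord.
apply: cvg_mulmx => //; apply: cvg_mulmx; last exact: cvg_cst.
exact: cvg_trmx.
Qed.

End mx_limits.

Lemma ultra_fmap (T U : Type) (F : set_system T) (UF : UltraFilter F)
    (f : T -> U) : UltraFilter (f @ F).
Proof.
apply: Build_UltraFilter => G GF sFG; apply/seteqP; split => // A GA.
have [//|FA] := in_ultra_setVsetC (f @^-1` A) UF.
have : G (A `&` ~` A) by apply: filterI => //; apply: sFG.
by rewrite setICr => /filter_not_empty.
Qed.

Lemma ultra_cvg_bounded (R : realType) (T : Type) (F : set_system T)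
    (UF : UltraFilter F) (f : T -> R) (C : R) :
  (\forall t \near F, `|f t| <= C) -> exists l : R, f t @[t --> F] --> l.
Proof.
move=> fC; have := @segment_compact R (- C) C; rewrite compact_ultra.
move=> /(_ (f @ F) (ultra_fmap UF f)) [].
- by rewrite /nbhs/=; apply: filterS fC => t; rewrite /= in_itv/= ler_norml.
- by move=> l [_ fl]; exists l.
Qed.

(** Limits along an ultrafilter stand in for the extraction of convergent
    subsequences: they exist for all bounded families at once. *)
Lemma ultra_cvg_bounded_mx (R : realType) (T : Type) (F : set_system T)
    (UF : UltraFilter F) (a b : nat) (f : T -> 'M[R]_(a, b)) (C : R) :
  (\forall t \near F, `|f t| <= C) ->
  exists M : 'M[R]_(a, b), f t @[t --> F] --> M.
Proof.
move=> fC.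
have H (ij : 'I_a * 'I_b) : exists l : R, f t ij.1 ij.2 @[t --> F] --> l.
  apply: (@ultra_cvg_bounded _ _ _ _ _ C); apply: filterS fC => t.
  apply: le_trans; rewrite [leRHS]/Num.norm/= mx_normrE.
  exact: (@le_bigmax _ _ _ 0 (fun k : 'I_a * 'I_b => `|f t k.1 k.2|) ij).
have [l lP] := choice H.
exists (\matrix_(i, j) l (i, j)); apply: cvg_mx => i j; rewrite mxE.
exact: (lP (i, j)).
Qed.

Section bounds.
Context {R : realType}.

Lemma bounded_set_norm_le (V : normedModType R) (A : set V) :
  bounded_set A -> exists2 C : R, 0 <= C & forall v, A v -> `|v| <= C.
Proof.
move=> [M [_ MA]]; exists (`|M| + 1); first by rewrite addr_ge0.
by move=> v Av; apply: (MA (`|M| + 1)) => //;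
  rewrite (le_lt_trans (ler_norm _))// ltrDl.
Qed.

Lemma coord_le_norm (a b : nat) (M : 'M[R]_(a, b)) i j : `|M i j| <= `|M|.
Proof.
rewrite [leRHS]/Num.norm/= mx_normrE.
exact: (@le_bigmax _ _ _ 0 (fun k : 'I_a * 'I_b => `|M k.1 k.2|) (i, j)).
Qed.

Lemma norm_le_coord (a b : nat) (M : 'M[R]_(a, b)) (C : R) :
  0 <= C -> (forall i j, `|M i j| <= C) -> `|M| <= C.
Proof.
move=> C0 MC; rewrite [leLHS]/Num.norm/= mx_normrE.
by apply/bigmax_leP; split => // -[i j] _; exact: MC.
Qed.

Lemma norm_mulmx_le (a b c : nat) (A : 'M[R]_(a, b)) (B : 'M[R]_(b, c)) :
  `|A *m B| <= b%:R * `|A| * `|B|.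
Proof.
apply: norm_le_coord => [|i j]; first by rewrite !mulr_ge0.
rewrite mxE (le_trans (ler_norm_sum _ _ _))//.
rewrite -mulrA mulr_natl -[X in _ *+ X]card_ord -sumr_const.
by apply: ler_sum => k _; rewrite normrM ler_pM// coord_le_norm.
Qed.

Lemma norm_trmx (a b : nat) (A : 'M[R]_(a, b)) : `|A^T| = `|A|.
Proof.
apply/eqP; rewrite eq_le; apply/andP; split; apply: norm_le_coord => // i j.
  by rewrite mxE coord_le_norm.
by have := coord_le_norm A^T j i; rewrite mxE.
Qed.

Lemma qform_le_norm (a : nat) (S : 'M[R]_a) (x : 'cV[R]_a) :
  `|qform S x| <= a%:R ^+ 2 * `|S| * `|x| ^+ 2.
Proof.
rewrite (le_trans (coord_le_norm _ _ _))// (le_trans (norm_mulmx_le _ _))//.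
have -> : a%:R ^+ 2 * `|S| * `|x| ^+ 2 = a%:R * (a%:R * `|x^T| * `|S|) * `|x|.
  by rewrite norm_trmx; ring.
by apply: ler_wpM2r => //; apply: ler_wpM2l => //; exact: norm_mulmx_le.
Qed.

Lemma qform_bounded (p : nat) (S : 'M[R]_p) (x : 'cV[R]_p) D :
  `|x| <= D -> qform S x <= p%:R ^+ 2 * `|S| * D ^+ 2.
Proof.
move=> xD; apply: le_trans (ler_norm _) _; apply: le_trans (qform_le_norm _ _)
  _.
by rewrite ler_wpM2l ?mulr_ge0 ?exprn_ge0// lerXn2r// nnegrE// (le_trans _ xD).
Qed.

Lemma sqnorm_ge0 (a : nat) (x : 'cV[R]_a) : 0 <= sqnorm x.
Proof. by apply: sumr_ge0 => i _; rewrite sqr_ge0. Qed.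

Lemma normsq_le_sqnorm (a : nat) (x : 'cV[R]_a) : `|x| ^+ 2 <= sqnorm x.
Proof.
have h : `|x| <= Num.sqrt (sqnorm x).
  apply: norm_le_coord => [|i j]; first exact: sqrtr_ge0.
  rewrite ord1 -sqrtr_sqr ler_wsqrtr// /sqnorm (bigD1 i)//=.
  by rewrite lerDl; apply: sumr_ge0 => k _; rewrite sqr_ge0.
by rewrite (le_trans (lerXn2r 2 _ _ h)) ?nnegrE ?sqrtr_ge0// sqr_sqrtr//
  sqnorm_ge0.
Qed.

Lemma sqnorm_le_normsq (a : nat) (x : 'cV[R]_a) : sqnorm x <= a%:R * `|x| ^+ 2.
Proof.
rewrite mulr_natl -[X in _ *+ X]card_ord -sumr_const; apply: ler_sum => i _.
by rewrite -[leLHS]real_normK ?num_real// lerXn2r ?nnegrE// coord_le_norm.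
Qed.

Lemma qformZ (a : nat) (S : 'M[R]_a) (k : R) (x : 'cV[R]_a) :
  qform S (k *: x) = k ^+ 2 * qform S x.
Proof.
rewrite /qform.
have -> : (k *: x)^T = k *: x^T by apply/matrixP => i j; rewrite !mxE.
by rewrite -scalemxAr mxE -!scalemxAl [X in _ * X]mxE mulrA expr2.
Qed.

(** If no l were suitable, unit vectors t k with qform S (t k) <= 1/(k+1) would
    accumulate at a unit vector on which S is not positive. *)
Lemma pd_ge_sqnorm (a : nat) (S : 'M[R]_a) : pd S ->
  exists2 l : R, 0 < l & forall x, l * sqnorm x <= qform S x.
Proof.
move=> [_ Spos]; apply: contrapT => /forall2NP nol.
have /choice[t tP] (k : nat) : exists x : 'cV[R]_a, `|x| = 1 /\ qform S x <=
  k.+1%:R^-1.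
  have [/negP|/existsNP[x]] := nol (a.+1%:R^-1 * k.+1%:R^-1).
    by rewrite mulr_gt0 ?invr_gt0 ?ltr0n.
  move=> /negP; rewrite -ltNge => xlt.
  have x0 : `|x| != 0.
    apply: contraTneq xlt => /normr0_eq0 ->.
    rewrite /qform mulmx0 mxE /sqnorm big1 ?mulr0 ?ltxx// => i _.
    by rewrite mxE expr0n.
  have xp : 0 < `|x| by rewrite lt_def x0 normr_ge0.
  exists (`|x|^-1 *: x); split.
    by rewrite normrZ ger0_norm ?invr_ge0// mulVf.
  rewrite qformZ exprVn ler_pdivrMl ?exprn_gt0// (le_trans (ltW xlt))//.
  rewrite mulrC mulrA; apply: ler_wpM2r; first by rewrite invr_ge0.
  rewrite ler_pdivrMr ?ltr0n// (le_trans (sqnorm_le_normsq x))// mulrC.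
  by rewrite ler_wpM2l ?sqr_ge0// ler_nat.
have [G [UG sG]] := @ultraFilterLemma _ (\oo : set_system nat) _.
have [l tl] : exists l : 'cV[R]_a, t k @[k --> G] --> l.
  apply: (ultra_cvg_bounded_mx UG (C := 1)).
  by apply: (@filterS _ G _ setT) filterT => k _; rewrite /= (tP k).1.
have l1 : `|l| = 1.
  have h : `|t k| @[k --> G] --> `|l| by exact: cvg_norm.
  have h1 : `|t k| @[k --> G] --> (1 : R).
    by under eq_fun do rewrite (tP _).1; exact: cvg_cst.
  exact: (cvg_unique _ h h1).
have : qform S l <= 0.
  have h2 : (k.+1%:R^-1 : R) @[k --> G] --> (0 : R).
    have h3 := @cvg_harmonic R.
    by move=> A /h3; rewrite /nbhs/=; exact: sG.
  have := ler_cvg_to (cvg_qform (S := S) tl) h2; apply.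
  by apply: (@filterS _ G _ setT) filterT => k _; exact: (tP k).2.
rewrite leNgt Spos//; apply/eqP => l0; move: l1; rewrite l0 normr0 => /eqP.
by rewrite eq_sym oner_eq0.
Qed.

End bounds.

Section qform_algebra.
Context {R : realType} {p : nat}.
Implicit Types (S T : 'M[R]_p) (x : 'cV[R]_p).

Lemma qformD S T x : qform (S + T) x = qform S x + qform T x.
Proof. by rewrite /qform mulmxDr mulmxDl mxE. Qed.

Lemma qformN S x : qform (- S) x = - qform S x.
Proof. by rewrite /qform mulmxN mulNmx mxE. Qed.

Lemma qform_congr (r : nat) (U : 'M[R]_r) (K : 'M[R]_(r, p)) x :
  qform (K^T *m U *m K) x = qform U (K *m x).
Proof. by rewrite /qform trmx_mul !mulmxA. Qed.

End qform_algebra.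

(** * Borel measurability of vector-valued maps *)

Section borel_vectors.
Context {R : realType} {p : nat}.

Lemma open_measurableV (U : set 'cV[R]_p) :
  open U -> measurable (U : set (borelV R p)).
Proof. by move=> oU; apply: sub_sigma_algebra. Qed.

Lemma closed_measurableV (U : set 'cV[R]_p) :
  closed U -> measurable (U : set (borelV R p)).
Proof.
move=> /closed_openC oU; rewrite -[U]setCK.
by apply: measurableC; exact: open_measurableV.
Qed.

Lemma measurable_coordV (i : 'I_p) :
  measurable_fun [set: borelV R p] (fun x : borelV R p => (x : 'cV[R]_p) i 0).
Proof.
apply: (measurability _ (RGenOpens.measurableE R)).
move=> _ [B oB <-]; rewrite setTI; apply: open_measurableV.
move: oB => [a [b ->]].
by apply: open_comp => //; move=> x _; exact: coord_continuous.
Qed.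

Lemma rat_near (x e : R) : 0 < e -> exists r : rat, `|x - ratr r| < e.
Proof.
move=> e0; have /rat_in_itvoo[r] : x - e < x + e by lra.
by rewrite in_itv/= => xr; exists r; rewrite distrC ltr_distl.
Qed.

(** The Borel sets are generated by the coordinates, because an open set is the
    countable union of the rational boxes that it contains. *)
Lemma measurable_funV d (T : measurableType d) (f : T -> borelV R p) :
  (forall i, measurable_fun setT (fun t => (f t : 'cV[R]_p) i 0)) ->
  measurable_fun setT f.
Proof.
move=> mf; apply: (@measurability _ _ T (borelV R p) setT f (@open 'cV[R]_p)
  erefl).
move=> _ [U oU <-]; rewrite setTI.
pose box (c : 'cV[rat]_p * rat) : set 'cV[R]_p :=
  [set x | forall i, `|x i 0 - ratr (c.1 i 0)| < ratr c.2].
pose B (c : 'cV[rat]_p * rat) : set T := if `[< box c `<=` U >] then f @^-1` box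
  c else set0.
have -> : f @^-1` U = \bigcup_c B c.
  apply/seteqP; split => [t /= Ut|t [c _]]; last first.
    by rewrite /B; case: asboolP => // bU; exact: bU.
  have /nbhs_ballP[e /= e0 eU] : nbhs (f t : 'cV[R]_p) U by apply:
    open_nbhs_nbhs.
  have [r] : exists r : rat, ratr r \in `]0, (e / 2)[ by apply: rat_in_itvoo;
    lra.
  rewrite in_itv/= => /andP[r0 re].
  have /choice[c cP] := fun i => rat_near ((f t : 'cV[R]_p) i 0) r0.
  exists (\col_i c i, r) => //; rewrite /B; case: asboolP => [_|[]].
    by move=> i; rewrite /= mxE.
  move=> y By; apply: eU; split => // i j; rewrite ord1.
  have := By i; rewrite /= mxE => yc; rewrite /ball/=.
  rewrite (le_lt_trans (ler_distD (ratr (c i)) _ _))// (splitr e).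
  by rewrite ltrD// ?(lt_trans (cP i)) 1?distrC ?(lt_trans yc).
apply: countable_bigcupT_measurable => [|c]; first exact: countableP.
rewrite /B; case: asboolP => // _.
have -> : f @^-1` box c =
    \bigcap_(i in [set: 'I_p]) [set t | `|(f t : 'cV[R]_p) i 0 - ratr (c.1 i 0)|
      < ratr c.2].
  by apply/seteqP; split => [t h i _|t h i]; exact: h.
apply: fin_bigcap_measurable => // i _.
rewrite -[X in measurable X]setTI.
have m1 : measurable_fun setT (fun t => `|(f t : 'cV[R]_p) i 0 - ratr
  (c.1 i 0)|).
  apply: measurableT_comp => //; apply: measurable_funB => //; exact: mf.
rewrite [X in _ `&` X](_ : _ =
  (fun t => `|(f t : 'cV[R]_p) i 0 - ratr (c.1 i 0)|) @^-1` `]-oo, ratr c.2[).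
  exact: m1.
by apply/seteqP; split => t; rewrite /= in_itv.
Qed.

End borel_vectors.

Section borel_algebra.
Context {R : realType} d (T : measurableType d).

Lemma measurable_coord_comp (p : nat) (f : T -> borelV R p) i :
  measurable_fun setT f -> measurable_fun setT (fun t => (f t : 'cV[R]_p) i 0).
Proof. by move=> mf; apply: (measurableT_comp (measurable_coordV i) mf). Qed.

Lemma measurable_mulmxV (a p : nat) (A : 'M[R]_(a, p)) (f : T -> borelV R p) :
  measurable_fun setT f ->
  measurable_fun setT (fun t => A *m (f t : 'cV[R]_p) : borelV R a).
Proof.
move=> mf; apply: measurable_funV => i; under eq_fun do rewrite mxE.
apply: measurable_sum => k; apply: measurable_funM => //.
exact: measurable_coord_comp.
Qed.

Lemma measurable_addV (p : nat) (f g : T -> borelV R p) :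
  measurable_fun setT f -> measurable_fun setT g ->
  measurable_fun setT (fun t => (f t : 'cV[R]_p) + (g t : 'cV[R]_p) :
    borelV R p).
Proof.
move=> mf mg; apply: measurable_funV => i; under eq_fun do rewrite mxE.
by apply: measurable_funD; exact: measurable_coord_comp.
Qed.

Lemma measurable_sumV (p : nat) (I : Type) (s : seq I) (P : pred I) (f :
    I -> T -> borelV R p) :
  (forall i, measurable_fun setT (f i)) ->
  measurable_fun setT (fun t => \sum_(i <- s | P i) (f i t : 'cV[R]_p) :
    borelV R p).
Proof.
move=> mf; elim: s => [|i s IH].
  under eq_fun do rewrite big_nil; exact: measurable_cst.
case Pi : (P i); last by under eq_fun do rewrite big_cons Pi.
by under eq_fun do rewrite big_cons Pi; exact: measurable_addV.
Qed.

Lemma measurable_qform (p : nat) (S : 'M[R]_p) (f : T -> borelV R p) :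
  measurable_fun setT f -> measurable_fun setT
    (fun t => qform S (f t : 'cV[R]_p)).
Proof.
move=> mf; rewrite /qform.
under eq_fun do rewrite -mulmxA mxE.
apply: measurable_sum => k; apply: measurable_funM.
  by under eq_fun do rewrite mxE; exact: measurable_coord_comp.
by apply: measurable_coord_comp; exact: measurable_mulmxV.
Qed.

Lemma measurable_sqnorm (p : nat) (f : T -> borelV R p) :
  measurable_fun setT f -> measurable_fun setT
    (fun t => sqnorm (f t : 'cV[R]_p)).
Proof.
move=> mf; rewrite /sqnorm.
apply: measurable_sum => k; apply: measurable_funX.
exact: measurable_coord_comp.
Qed.

End borel_algebra.

Section borel_sequences.
Context {R : realType} {p : nat} {I : Type}.

Lemma measurable_seqV d (T : measurableType d) (f : T -> seqV R p I) :
  (forall i, measurable_fun setT (fun t => f t i : borelV R p)) ->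
  measurable_fun setT f.
Proof.
move=> mf; apply: (@measurability _ _ T (seqV R p I) setT f (cylinders R p I)
  erefl).
move=> _ [_ [i [B [mB ->]]] <-]; rewrite setTI.
by have := mf i measurableT _ mB; rewrite setTI.
Qed.

End borel_sequences.

(** * Integrals of functions of two independent variables *)

(** Packs a map that is proved measurable only after it has been defined. *)
Definition mfun_of d d' (T : measurableType d) (T' : measurableType d')
    (f : T -> T') (mf : measurable_fun setT f) : {mfun T >-> T'} :=
  MeasurableFun.Pack (MeasurableFun.Class (isMeasurableFun.Build _ _ _ _ f mf)).

Section independent_pair.
Context {R : realType} d d1 d2 {T : measurableType d} {T1 : measurableType d1}
  {T2 : measurableType d2} (P : probability T R).
Variables (X : {mfun T >-> T1}) (Y : {mfun T >-> T2}).
Hypothesis XY : forall A B, measurable A -> measurable B ->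
  P (X @^-1` A `&` Y @^-1` B) = (P (X @^-1` A) * P (Y @^-1` B))%E.

Let mZ : measurable_fun setT (fun t => (X t, Y t)).
Proof. by apply: measurable_fun_pair. Qed.

Let Z : {mfun T >-> (T1 * T2)%type} := mfun_of mZ.

Let jointE (C : set (T1 * T2)) : measurable C ->
  (distribution P X \x distribution P Y)%E C =
  distribution P Z C.
Proof. by move=> mC; apply: product_measure_unique. Qed.

(** By uniqueness of product measures the joint law of (X, Y) is the product of
    the two laws; what remains is the theorem of Tonelli. *)
Lemma ge0_integral_independent (f : T1 * T2 -> \bar R) :
  measurable_fun setT f -> (forall z, 0 <= f z)%E ->
  (\int[P]_t f (X t, Y t) = \int[P]_t \int[distribution P Y]_y f (X t, y))%E.
Proof.
move=> mf f0.
transitivity (\int[distribution P Z]_z f z)%E.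
  by rewrite ge0_integral_distribution.
transitivity (\int[(distribution P X \x distribution P Y)%E]_z f z)%E.
  by apply: eq_measure_integral => C mC _; exact: (esym (jointE mC)).
rewrite fubini_tonelli1// /fubini_F.
rewrite (@ge0_integral_distribution _ _ _ _ _ P X
  (fun x => \int[distribution P Y]_y f (x, y))%E)//.
- exact: (measurable_fun_fubini_tonelli_F f).
- by move=> x; apply: integral_ge0.
Qed.

Lemma integral_independent (f : T1 * T2 -> \bar R) :
  measurable_fun setT f -> P.-integrable setT (fun t => f (X t, Y t)) ->
  (\int[P]_t f (X t, Y t) =
   \int[distribution P X]_x \int[distribution P Y]_y f (x, y))%E.
Proof.
move=> mf intf.
rewrite -(@integral_distribution _ _ _ _ _ P Z f)//.
transitivity (\int[(distribution P X \x distribution P Y)%E]_z f z)%E.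
  by apply: eq_measure_integral => C mC _; exact: (esym (jointE mC)).
rewrite -integral12_prod_meas1//.
apply/integrableP; split => //.
rewrite (@eq_measure_integral _ _ _ _ (distribution P Z)); last first.
  by move=> C mC _; exact: jointE.
rewrite ge0_integral_distribution//; last exact: measurableT_comp.
by have /integrableP[] := intf.
Qed.

End independent_pair.

Section bounded_rv.
Context {R : realType} d {T : measurableType d} (P : probability T R).

Lemma ae_bounded_integrable (f : T -> R) (C : R) :
  measurable_fun setT f -> {ae P, forall t, `|f t| <= C} ->
  P.-integrable setT (EFin \o f).
Proof.
move=> mf fC; apply/integrableP; split; first exact/measurable_EFinP.
apply: (@le_lt_trans _ _ (\int[P]_t `|C|%:E)%E).
  apply: ae_ge0_le_integral => //.
  - by apply: measurableT_comp => //; exact/measurable_EFinP.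
  - by apply: filterS fC => t ft _; rewrite lee_fin (le_trans ft)// ler_norm.
by rewrite integral_cst//= probability_setT mule1 ltry.
Qed.

End bounded_rv.

(** * Moments of the disturbances *)

Section has_mean.
Context {R : realType} d {T : measurableType d} (P : probability T R).
Implicit Types (f g : T -> R) (a b c : R).

(** Integrability is bundled with the value, so that sums and multiples can be
    formed without side conditions. *)
Definition has_mean f a : Prop :=
  P.-integrable setT (EFin \o f) /\ (\int[P]_t (f t)%:E = a%:E)%E.

Lemma has_mean_eq f g a b : f =1 g -> a = b -> has_mean f a -> has_mean g b.
Proof. by move=> /funext -> ->. Qed.

Lemma has_mean_cst c : has_mean (fun=> c) c.
Proof.
split; first exact: finite_measure_integrable_cst.
by rewrite integral_cst//= probability_setT mule1.
Qed.

Lemma has_meanD f g a b :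
  has_mean f a -> has_mean g b -> has_mean (fun t => f t + g t) (a + b).
Proof.
move=> [fi fa] [gi gb]; split; first exact: (integrableD measurableT fi gi).
under eq_integral do rewrite EFinD.
by rewrite (integralD measurableT fi gi)/= fa gb.
Qed.

Lemma has_meanZ (k : R) f a : has_mean f a -> has_mean (fun t => k * f t)
    (k * a).
Proof.
move=> [fi fa]; split; first exact: (integrableZl measurableT k fi).
under eq_integral do rewrite EFinM.
by rewrite (integralZl measurableT fi)/= fa.
Qed.

Lemma has_mean_sum (J : finType) (f : J -> T -> R) (a : J -> R) :
  (forall j, has_mean (f j) (a j)) ->
  has_mean (fun t => \sum_j f j t) (\sum_j a j).
Proof.
move=> fa; elim: (index_enum J) => [|j s IH].
  rewrite big_nil; under eq_fun do rewrite big_nil; exact: has_mean_cst.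
rewrite big_cons; under eq_fun do rewrite big_cons; exact: has_meanD.
Qed.

Lemma has_mean_ge0 f a : (forall t, 0 <= f t) -> has_mean f a -> 0 <= a.
Proof.
move=> f0 [_ fa]; rewrite -lee_fin -fa; apply: integral_ge0 => t _.
by rewrite lee_fin.
Qed.

(** When the square is expanded, the terms linear in the X j vanish in the mean
    and only the covariances C j k survive. *)
Lemma has_mean_quadratic (J : finType) (X : J -> T -> R) (C : J -> J -> R)
    (p : nat) (Q : 'M[R]_p) (z : 'cV[R]_p) (s : J -> 'cV[R]_p) :
  (forall j, has_mean (X j) 0) ->
  (forall j k, has_mean (fun t => X j t * X k t) (C j k)) ->
  has_mean (fun t => qform Q (z + \sum_j X j t *: s j))
    (qform Q z + \sum_j \sum_k C j k * ((s j)^T *m Q *m s k) 0 0).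
Proof.
move=> X0 XC.
have addE (A B : 'M[R]_1) : (A + B) 0 0 = A 0 0 + B 0 0 by rewrite mxE.
have trD (x y : 'cV[R]_p) : (x + y)^T = x^T + y^T by exact: linearD.
have trZ (c : R) (x : 'cV[R]_p) : (c *: x)^T = c *: x^T by exact: linearZ.
have trsum (f : J -> 'cV[R]_p) : (\sum_j f j)^T = \sum_j (f j)^T by exact:
  linear_sum.
have E t : qform Q z + (\sum_j ((z^T *m Q *m s j) 0 0 + ((s j)^T *m Q *m z) 0 0)
  * X j t +
    \sum_j \sum_k ((s j)^T *m Q *m s k) 0 0 * (X j t * X k t)) =
    qform Q (z + \sum_j X j t *: s j).
  rewrite /qform trD !mulmxDl !mulmxDr !addE -[RHS]addrA; congr (_ + _).
  rewrite trsum !mulmx_suml !mulmx_sumr !summxE [RHS]addrA -big_split/=.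
  rewrite -!big_split/=; apply: eq_bigr => j _.
  have sE (A : 'M[R]_1) (c : R) : (c *: A) 0 0 = c * A 0 0 by rewrite mxE.
  rewrite trZ -!scalemxAl -scalemxAr !sE mulmx_sumr summxE mulr_sumr.
  congr (_ + _); first by ring.
  by apply: eq_bigr => k _; rewrite -scalemxAr sE; ring.
pose l j := (z^T *m Q *m s j) 0 0 + ((s j)^T *m Q *m z) 0 0.
pose b j k := ((s j)^T *m Q *m s k) 0 0.
have H1 : has_mean (fun t => \sum_j l j * X j t) (\sum_j l j * 0).
  by apply: has_mean_sum => j; apply: has_meanZ.
have H2 : has_mean (fun t => \sum_j \sum_k b j k * (X j t * X k t))
    (\sum_j \sum_k b j k * C j k).
  by apply: has_mean_sum => j; apply: has_mean_sum => k; apply: has_meanZ.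
apply: has_mean_eq E _ (has_meanD (has_mean_cst _) (has_meanD H1 H2)).
rewrite [X in _ + (X + _)]big1 ?add0r; last by move=> j _; rewrite mulr0.
by congr (_ + _); apply: eq_bigr => j _; apply: eq_bigr => k _; rewrite mulrC.
Qed.

End has_mean.

Section disturbance_moments.
Context {R : realType} {q : nat} {W : set 'cV[R]_q} {d : R * 'M[R]_q}.
Hypotheses (Wclosed : closed W) (Wbounded : bounded_set W).

Lemma ae_in_support (mu : probability (borelV R q) R) :
  mu (W : set (borelV R q)) = 1%E -> {ae mu, forall v : borelV R q, W v}.
Proof.
move=> muW; have mW := closed_measurableV Wclosed.
exists (~` (W : set (borelV R q))); split.
- exact: measurableC.
- by rewrite probability_setC// muW subee.
- by move=> v; apply: contra_not => Wv.
Qed.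

Section one_law.
Variable mu : probability (borelV R q) R.
Hypothesis muW : zero_mean_laws W mu.

Lemma law_coord_mean (a : 'I_q) :
  has_mean mu (fun v : borelV R q => (v : 'cV[R]_q) a 0) 0.
Proof.
split; last by have := muW.2 a; rewrite unlock.
have [C _ WC] := bounded_set_norm_le Wbounded.
apply: (@ae_bounded_integrable _ _ _ _ _ C); first exact: measurable_coordV.
have FF := ae_filter_ringOfSetsType mu; apply: filterS (ae_in_support muW.1) =>
  v /WC.
by apply: le_trans; exact: coord_le_norm.
Qed.

Lemma law_coord_second_moment (a b : 'I_q) :
  has_mean mu (fun v : borelV R q => (v : 'cV[R]_q) a 0 * (v : 'cV[R]_q) b 0)
    (second_moment mu a b).
Proof.
have [C C0 WC] := bounded_set_norm_le Wbounded.
have I : mu.-integrable setT (EFin \o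
    (fun v : borelV R q => (v : 'cV[R]_q) a 0 * (v : 'cV[R]_q) b 0)).
  apply: (@ae_bounded_integrable _ _ _ _ _ (C * C)).
    by apply: measurable_funM; exact: measurable_coordV.
  have FF := ae_filter_ringOfSetsType mu; apply: filterS (ae_in_support muW.1)
    => v /WC vC.
  by rewrite normrM ler_pM// (le_trans (coord_le_norm _ _ _) vC).
split => //; rewrite mxE unlock fineK//; exact: integrable_fin_num.
Qed.

Lemma law_qform_mean (S : 'M[R]_q) :
  has_mean mu (fun v : borelV R q => qform S (v : 'cV[R]_q))
    (\tr (S *m second_moment mu)).
Proof.
apply: has_mean_eq _ _ (has_mean_sum (fun a => has_mean_sum (fun b =>
  has_meanZ (S a b) (law_coord_second_moment b a)))).
- move=> v; rewrite /qform -mulmxA mxE; apply: eq_bigr => a _.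
  by rewrite !mxE mulr_sumr; apply: eq_bigr => b _; ring.
- by apply: eq_bigr => a _; rewrite mxE.
Qed.

End one_law.

Section sequence_law.
Context {I : eqType} {P : probability (seqV R q I) R}.
Hypothesis PW : ambiguity_laws W d P.

Lemma ae_in_support_seq (i : I) : {ae P, forall w : seqV R q I, W (w i)}.
Proof.
have [[PW1 _] _] := PW.2 i.
have mW := closed_measurableV Wclosed.
exists (coord i @^-1` (~` (W : set (borelV R q)))); split.
- by rewrite -[X in measurable X]setTI; apply: measurable_coord => //; exact:
  measurableC.
- rewrite -preimage_setC probability_setC ?(PW1) ?subee//; last first.
    by rewrite -[X in measurable X]setTI; apply: measurable_coord.
  by rewrite [X in (_ - X)%E](_ : _ = 1%E) ?subee.
- by move=> w; apply: contra_not => Wv.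
Qed.

Lemma has_mean_coord_comp (i : I) (f : borelV R q -> R) (a : R) :
  measurable_fun setT f ->
  has_mean (distribution P (coord i)) f a -> has_mean P (fun w => f (coord i w))
    a.
Proof.
move=> mf [fi fa].
have fi' : P.-integrable setT (EFin \o f \o coord i).
  apply/integrableP; split.
    by apply: measurableT_comp; [exact/measurable_EFinP|exact:
      measurable_coord].
  have /integrableP[_] := fi.
  rewrite ge0_integral_distribution//.
  by apply: measurableT_comp => //; exact/measurable_EFinP.
split => //; rewrite -fa integral_distribution//; exact/measurable_EFinP.
Qed.

Lemma pair_independent (i j : I) (A B : set (borelV R q)) : i != j ->
  measurable A -> measurable B ->
  P (coord i @^-1` A `&` coord j @^-1` B) =
  (P (coord i @^-1` A) * P (coord j @^-1` B))%E.
Proof.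
move=> ij mA mB.
have := PW.1 [:: i; j] (fun k => if k == i then A else B).
rewrite /= inE ij => /(_ isT) H.
have := H (fun k => _); rewrite !big_cons big_nil mule1 eqxx.
rewrite eq_sym (negbTE ij) => <-; last by move=> k; case: ifP.
congr (P _); apply/seteqP; split => [w [wA wB] k/=|w h].
  by rewrite !inE => /orP[/eqP ->|/eqP ->]; rewrite ?eqxx// eq_sym (negbTE ij).
split; first by have := h i; rewrite /= !inE eqxx/=; apply.
by have := h j; rewrite /= !inE eqxx orbT eq_sym (negbTE ij)/=; apply.
Qed.

Definition covmx (i : I) : 'M[R]_q := second_moment (distribution P (coord i)).

Lemma seq_coord_mean (i : I) (a : 'I_q) : has_mean P (fun w => w i a 0) 0.
Proof.
apply: (@has_mean_coord_comp i (fun v : borelV R q => (v : 'cV[R]_q) a 0)).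
  exact: measurable_coordV.
apply: law_coord_mean; exact: (PW.2 i).1.
Qed.

(** Distinct coordinates are uncorrelated: by independence the mean of their
    product is an iterated integral, and the inner one is a vanishing mean. *)
Lemma seq_coord_cov (i j : I) (a b : 'I_q) :
  has_mean P (fun w => w i a 0 * w j b 0) (if i == j then covmx i a b else 0).
Proof.
have [<-|ij] := eqVneq i j.
  apply: (@has_mean_coord_comp i (fun v : borelV R q => (v : 'cV[R]_q) a 0 *
    (v : 'cV[R]_q) b 0)).
    by apply: measurable_funM; exact: measurable_coordV.
  apply: law_coord_second_moment; exact: (PW.2 i).1.
have [C C0 WC] := bounded_set_norm_le Wbounded.
pose f (z : borelV R q * borelV R q) : \bar R :=
  ((z.1 : 'cV[R]_q) a 0 * (z.2 : 'cV[R]_q) b 0)%:E.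
have mf : measurable_fun setT f.
  apply/measurable_EFinP; apply: measurable_funM.
    by apply: measurable_coord_comp; exact: measurable_fst.
  by apply: measurable_coord_comp; exact: measurable_snd.
have fi :
  P.-integrable setT (EFin \o (fun w : seqV R q I => w i a 0 * w j b 0)).
  apply: (@ae_bounded_integrable _ _ _ _ _ (C * C)).
    apply: measurable_funM.
      by apply: measurable_coord_comp; exact: (measurable_coord i).
    by apply: measurable_coord_comp; exact: (measurable_coord j).
  apply: filterS2 (ae_in_support_seq i) (ae_in_support_seq j) => w /WC wi /WC
    wj.
  by rewrite normrM ler_pM// (le_trans (coord_le_norm _ _ _)).
split => //.
have := @integral_independent _ _ _ _ _ _ _ P (coord i) (coord j) _ f mf fi.
move=> -> //; last by move=> A B; exact: pair_independent.
have [bi b0] := law_coord_mean (PW.2 j).1 b.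
under eq_integral => x _.
  rewrite /f/=; under eq_integral do rewrite EFinM.
  rewrite (integralZl measurableT bi) b0 mule0; over.
by rewrite integral0.
Qed.

End sequence_law.
Arguments covmx {I} P i.

Section affine_moments.
Context {I : finType} {P : probability (seqV R q I) R}.
Hypothesis PW : ambiguity_laws W d P.

(** This is [has_mean_quadratic] for the scalar disturbances w i a, indexed by
    the pairs (i, a); their covariance matrix is block diagonal. *)
Lemma has_mean_qform_affine (p : nat) (Q : 'M[R]_p) (z : 'cV[R]_p)
    (S : I -> 'M[R]_(p, q)) :
  has_mean P (fun w => qform Q (z + \sum_i S i *m w i))
    (qform Q z + \sum_i \tr ((S i)^T *m Q *m S i *m covmx P i)).
Proof.
apply: has_mean_eq; last first.
- apply: (@has_mean_quadratic _ _ _ P (I * 'I_q)%type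
  (fun ia w => w ia.1 ia.2 0)
   (fun ia jb => if ia.1 == jb.1 then covmx P ia.1 ia.2 jb.2 else 0)
   p Q z (fun ia => col ia.2 (S ia.1))).
  + by move=> ia; exact: seq_coord_mean.
  + by move=> ia jb; exact: seq_coord_cov.
- congr (_ + _).
  rewrite -(pair_big xpredT xpredT (fun i a => \sum_(jb : I * 'I_q)
     (if i == jb.1 then covmx P i a jb.2 else 0) * ((col a (S i))^T *m Q *m col
       jb.2 (S jb.1)) 0 0))/=.
  apply: eq_bigr => i _; rewrite /mxtrace; apply: eq_bigr => a _.
  rewrite mxE -(pair_big xpredT xpredT (fun j b =>
     (if i == j then covmx P i a b else 0) * ((col a (S i))^T *m Q *m col b
       (S j)) 0 0))/=.
  rewrite (bigD1 i)//= [X in _ + X]big1 ?addr0; last first.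
    by move=> j ji; rewrite big1// => b _; rewrite eq_sym (negbTE ji) mul0r.
  apply: eq_bigr => b _; rewrite eqxx mulrC; congr (_ * _); last first.
    by rewrite /covmx !mxE; congr (fine _); congr expectation; apply/funext =>
      v; rewrite mulrC.
  rewrite !mxE; apply: eq_bigr => k _; rewrite !mxE; congr (_ * _).
  by apply: eq_bigr => l _; rewrite !mxE.
- move=> w /=; congr (qform Q (z + _)).
  rewrite -(pair_big xpredT xpredT (fun i a => w i a 0 *: col a (S i)))/=.
  apply: eq_bigr => i _; apply/colP => k; rewrite summxE mxE.
  by apply: eq_bigr => a _; rewrite !mxE mulrC.
Qed.

End affine_moments.
End disturbance_moments.
Arguments covmx {R q I} P i : rename.

(** * Response to the disturbances, terminal feedback and shifted policies *)

(** Splits off the first index; the last term on the right has no successor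
    index and is neutral. *)
Lemma big_ord_shift (V : Type) (idx : V) (op : Monoid.law idx) (N : nat)
    (N0 : (0 < N)%N) (g : 'I_N -> V) :
  \big[op/idx]_j g j = op (g (Ordinal N0))
    (\big[op/idx]_(j < N) (if insub j.+1 is Some j' then g j' else idx)).
Proof.
case: N N0 g => // N N0 g; have -> : Ordinal N0 = ord0 by exact: val_inj.
set h := \big[_/_]_(j < N.+1) _; have -> : h = \big[op/idx]_(i < N) g
  (lift ord0 i).
  rewrite /h big_ord_recr/= insubF ?ltnn// Monoid.mulm1; apply: eq_bigr => j _.
  by rewrite insubT/= ?ltnS// => h'; congr g; exact: val_inj.
exact: big_ord_recl.
Qed.

Section dynamics.
Context {R : realType} {n m q : nat} (mpc : mpc_problem R n m q).
Local Notation N := (horizon mpc).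
Local Notation A := (dynA mpc).
Local Notation B := (dynB mpc).
Local Notation G := (dynG mpc).
Local Notation ord0N := (Ordinal (horizon_gt0 mpc)).
Implicit Types (x y : 'cV[R]_n) (th : policy mpc) (w : 'I_N -> 'cV[R]_q)
  (M : 'I_N -> 'I_N -> 'M[R]_(m, q)).

(** An input reads only the blocks below the diagonal. With the gains
    truncated to these, it becomes an affine function of the whole disturbance
    sequence. *)
Definition cgain M (i j : 'I_N) : 'M[R]_(m, q) := if (j < i)%N then M i j else
    0.

Lemma inputE th w i :
  input th w i = offset th i + \sum_j cgain (gain th) i j *m w j.
Proof.
rewrite /input big_mkcond; congr (_ + _); apply: eq_bigr => j _.
by rewrite /cgain; case: ifP; rewrite ?mul0mx.
Qed.

Lemma input0 th i : input th (fun=> 0) i = offset th i.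
Proof. by rewrite inputE big1 ?addr0// => j _; exact: mulmx0. Qed.

Lemma stateS x th w (i : 'I_N) :
  state x th w i.+1 = A *m state x th w i + B *m input th w i + G *m w i.
Proof. by rewrite /= valK. Qed.

(** The coefficient of w(j) in x(k). The policy enters through its gains only:
    this is why the disturbance part of a cost ignores the offsets and the
    initial state. *)
Fixpoint resp M (k : nat) (j : 'I_N) : 'M[R]_(n, q) :=
  if k is k'.+1 then
    if insub k' is Some i
    then A *m resp M k' j + B *m cgain M i j + (if i == j then G else 0)
    else resp M k' j
  else 0.

Lemma respS M (i j : 'I_N) :
  resp M i.+1 j = A *m resp M i j + B *m cgain M i j +
    (if i == j then G else 0).
Proof. by rewrite /= valK. Qed.

Lemma resp_causal M k (j : 'I_N) : (k <= j)%N -> resp M k j = 0.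
Proof.
elim: k => [//|k IH] kj; have kN : (k < N)%N by rewrite (leq_trans kj)// ltnW.
rewrite -[k]/(val (Ordinal kN)) respS IH ?(ltnW kj)// mulmx0 add0r.
rewrite /cgain/= ltnNge (ltnW kj)/= mulmx0 add0r.
by case: eqP => // jE; move: kj; rewrite -jE ltnn.
Qed.

Lemma cgain_causal M (i j : 'I_N) : (i <= j)%N -> cgain M i j = 0.
Proof. by move=> ij; rewrite /cgain ltnNge ij. Qed.

Lemma input_affine th w i :
  input th w i = input th (fun=> 0) i + \sum_j cgain (gain th) i j *m w j.
Proof.
rewrite !inputE [X in _ = _ + X + _]big1 ?addr0// => j _; exact: mulmx0.
Qed.

Lemma state_affine x th w k :
  state x th w k = state x th (fun=> 0) k + \sum_j resp (gain th) k j *m w j.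
Proof.
elim: k => [|k IH]; first by rewrite /= big1 ?addr0// => j _; rewrite mul0mx.
have [kN|kN] := ltnP k N; last by rewrite /= insubF ?ltnNge ?kN//.
set i := Ordinal kN; rewrite -[k]/(val i) !stateS -[val i]/k IH input_affine.
rewrite mulmx0 addr0; set z := state _ _ _ _; set u := input _ _ _.
rewrite -[k]/(val i); under [in RHS]eq_bigr do rewrite respS !mulmxDl -!mulmxA.
rewrite !big_split/= -!mulmx_sumr.
have -> : \sum_j (if i == j then G else 0) *m w j = G *m w i.
  rewrite (bigD1 i)//= eqxx big1 ?addr0// => j /negPf.
  by rewrite eq_sym => ->; rewrite mul0mx.
have acE (V : zmodType) (a b c e f : V) : a + b + (c + e) + f = a + c +
  (b + e + f).
  by rewrite !addrA; congr (_ + _ + _); exact: addrAC.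
by rewrite !mulmxDr acE.
Qed.

Definition stage x th w (i : 'I_N) : R :=
  qform (costQ mpc) (state x th w i) + qform (costR mpc) (input th w i).

(** Charging the terminal cost at an intermediate time s lets costs telescope
    in s. *)
Definition pcost (s : nat) x th w : R :=
  \sum_(i < N | (i < s)%N) stage x th w i + qform (costP mpc) (state x th w s).

Lemma pcostN x th w : pcost N x th w = cost x th w.
Proof. by rewrite /pcost (eq_bigl xpredT)// => i; rewrite ltn_ord. Qed.

Lemma pcostS x th w (i : 'I_N) : pcost i.+1 x th w =
  pcost i x th w + stage x th w i +
  (qform (costP mpc) (state x th w i.+1) - qform (costP mpc) (state x th w i)).
Proof.
rewrite /pcost (bigD1 i)//= (eq_bigl (fun j : 'I_N => (j < i)%N)); first ring.
by move=> j; rewrite ltnS -val_eqE/= ltn_neqAle andbC.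
Qed.

Section switching.
Variable Kf : 'M[R]_(m, n).

(** Response, and below it the centre, of the trajectory that follows a policy
    up to time s and the state feedback Kf afterwards. From time s on, the gains
    and offsets of this trajectory are Kf times the response and the centre
    already computed, which rewrites state feedback as disturbance feedback. *)
Fixpoint sw_resp M (s k : nat) (j : 'I_N) : 'M[R]_(n, q) :=
  if k is k'.+1 then
    if insub k' is Some i
    then A *m sw_resp M s k' j +
         B *m (if (k' < s)%N then cgain M i j else Kf *m sw_resp M s k' j) +
         (if i == j then G else 0)
    else sw_resp M s k' j
  else 0.

Fixpoint sw_center y (v : 'I_N -> 'cV[R]_m) (s k : nat) : 'cV[R]_n :=
  if k is k'.+1 then
    if insub k' is Some i
    then A *m sw_center y v s k' +
         B *m (if (k' < s)%N then v i else Kf *m sw_center y v s k')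
    else sw_center y v s k'
  else y.

Definition sw_gain M (s : nat) (i j : 'I_N) : 'M[R]_(m, q) :=
  if (i < s)%N then cgain M i j else Kf *m sw_resp M s i j.

Definition switch (s : nat) y th : policy mpc :=
  Policy (sw_gain (gain th) s)
    (fun i => if (i < s)%N then offset th i else Kf *m sw_center y (offset th) s
      i).

Lemma sw_resp_causal M s k (j : 'I_N) : (k <= j)%N -> sw_resp M s k j = 0.
Proof.
elim: k => [//|k IH] kj; have kN : (k < N)%N by rewrite (leq_trans kj)// ltnW.
rewrite /= insubT/= IH ?(ltnW kj)// !mulmx0 add0r cgain_causal ?(ltnW kj)//.
rewrite if_same mulmx0 add0r.
by case: eqP => // jE; move: kj; rewrite -jE ltnn.
Qed.

Lemma sw_gain_causal M s (i j : 'I_N) : (i <= j)%N -> sw_gain M s i j = 0.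
Proof.
by move=> ij; rewrite /sw_gain cgain_causal// sw_resp_causal// mulmx0 if_same.
Qed.

Lemma causal_switch s y th : causal (switch s y th).
Proof. by move=> i j ij; exact: sw_gain_causal. Qed.

Lemma cgain_sw M s (i j : 'I_N) : cgain (sw_gain M s) i j = sw_gain M s i j.
Proof. by rewrite /cgain; case: ltnP => // ij; rewrite sw_gain_causal. Qed.

Lemma resp_sw M s k (j : 'I_N) : resp (sw_gain M s) k j = sw_resp M s k j.
Proof.
elim: k => [//|k IH] /=; case: insubP => [i _ iE|_]; rewrite IH//.
by rewrite cgain_sw /sw_gain iE.
Qed.

Lemma state_sw0 s y th k :
  state y (switch s y th) (fun=> 0) k = sw_center y (offset th) s k.
Proof.
elim: k => [//|k IH] /=; case: insubP => [i _ iE|_]; last exact: IH.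
by rewrite IH mulmx0 addr0 input0/= iE.
Qed.

Lemma input_switch_lt s y th w (i : 'I_N) : (i < s)%N ->
  input (switch s y th) w i = input th w i.
Proof.
move=> si; rewrite !inputE/= si; congr (_ + _); apply: eq_bigr => j _.
by rewrite cgain_sw /sw_gain si.
Qed.

Lemma input_switch_ge s y th w (i : 'I_N) : (s <= i)%N ->
  input (switch s y th) w i = Kf *m state y (switch s y th) w i.
Proof.
move=> si; rewrite state_affine inputE/= ltnNge si/= state_sw0 mulmxDr.
congr (_ + _); rewrite mulmx_sumr; apply: eq_bigr => j _.
by rewrite cgain_sw /sw_gain ltnNge si/= resp_sw mulmxA.
Qed.

Lemma state_switch s y th w k : (k <= s)%N ->
  state y (switch s y th) w k = state y th w k.
Proof.
elim: k => [//|k IH] ks /=; case: insubP => [i _ iE|_]; last exact: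
  IH (ltnW ks).
by rewrite (IH (ltnW ks)) input_switch_lt// iE.
Qed.

Lemma pcost_switch s y th w : pcost s y (switch s y th) w = pcost s y th w.
Proof.
rewrite /pcost state_switch//; congr (_ + _); apply: eq_bigr => i si.
by rewrite /stage state_switch 1?ltnW// input_switch_lt.
Qed.

(** From time s on the state remains in the terminal set, which the feedback
    leaves invariant. *)
Lemma admissible_switch s y th :
  (forall x, termX mpc x -> consZ mpc (x, Kf *m x)) ->
  (forall x v, termX mpc x -> distW mpc v ->
     termX mpc ((A + B *m Kf) *m x + G *m v)) ->
  (s <= N)%N ->
  (forall w, (forall i, distW mpc (w i)) ->
     (forall i : 'I_N, (i < s)%N -> consZ mpc (state y th w i, input th w i)) /\
     termX mpc (state y th w s)) ->
  admissible y (switch s y th).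
Proof.
move=> KZ KX sN H; split; first exact: causal_switch.
move=> w Ww; have [HZ HX] := H _ Ww.
have X k : (s <= k <= N)%N -> termX mpc (state y (switch s y th) w k).
  elim: k => [|k IH].
    by rewrite leqn0 => /andP[/eqP s0 _]; rewrite state_switch ?s0// -s0.
  rewrite leq_eqVlt => /andP[/orP[/eqP <- _|]]; first by rewrite state_switch.
  rewrite ltnS => sk kN; rewrite -[k]/(val (Ordinal kN)) stateS
    input_switch_ge//.
  rewrite mulmxA -mulmxDl; apply: KX => //; apply: IH; by rewrite sk ltnW.
split; last by apply: X; rewrite sN leqnn.
move=> k; have [ks|sk] := ltnP k s.
  by rewrite state_switch 1?ltnW// input_switch_lt//; exact: HZ.
by rewrite input_switch_ge//; apply: KZ; apply: X; rewrite sk ltnW.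
Qed.

End switching.

(** The tail of th once the first disturbance is known to be v: the blocks that
    multiply v move into the offsets, and the gains do not depend on v. *)
Definition shift th (v : 'cV[R]_q) : policy mpc :=
  Policy
    (fun i j => if insub i.+1 is Some i' then
       if insub j.+1 is Some j' then cgain (gain th) i' j' else 0 else 0)
    (fun i => if insub i.+1 is Some i' then
       offset th i' + cgain (gain th) i' ord0N *m v else 0).

Definition cons_seq (v : 'cV[R]_q) w : 'I_N -> 'cV[R]_q :=
  fun i => if (i : nat) is k.+1 then if insub k is Some j then w j else 0 else
    v.

Lemma cons_seqS v w (i j : 'I_N) : i = j.+1 :> nat -> cons_seq v w i = w j.
Proof. by rewrite /cons_seq => ->; rewrite valK. Qed.

Lemma cgain_shift th v (i j i' : 'I_N) : i' = i.+1 :> nat ->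
  cgain (gain (shift th v)) i j =
  if insub j.+1 is Some j' then cgain (gain th) i' j' else 0.
Proof.
move=> iE; rewrite {1}/cgain/=.
have -> : insub i.+1 = Some i' by rewrite -iE valK.
case: insubP => [j' _ jE|_]; last by rewrite if_same.
by case: ltnP => // ij; rewrite cgain_causal// jE iE ltnS.
Qed.

Lemma input_shift th v w (i i' : 'I_N) : i' = i.+1 :> nat ->
  input (shift th v) w i = input th (cons_seq v w) i'.
Proof.
move=> iE; rewrite !inputE/=.
have -> : insub i.+1 = Some i' by rewrite -iE valK.
rewrite [in RHS](big_ord_shift _ (horizon_gt0 mpc)) addrA; congr (_ + _).
apply: eq_bigr => j _; rewrite (cgain_shift th v j iE).
case: insubP => [j' _ jE|_]; last by rewrite mul0mx.
by rewrite (@cons_seqS _ _ _ j).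
Qed.

Lemma state_shift x th v w k : (k < N)%N ->
  state (A *m x + B *m offset th ord0N + G *m v) (shift th v) w k =
  state x th (cons_seq v w) k.+1.
Proof.
elim: k => [|k IH] kN.
  rewrite -[0%N in RHS]/(val ord0N) stateS inputE big1 ?addr0//= => j _.
  by rewrite /cgain ltn0 mul0mx.
have k'N := ltnW kN.
rewrite -[k.+1 in RHS]/(val (Ordinal kN)) stateS.
rewrite -[k in LHS]/(val (Ordinal k'N)) stateS IH//.
rewrite (@input_shift _ _ _ _ (Ordinal kN))//.
by rewrite (@cons_seqS _ _ (Ordinal kN) (Ordinal k'N)).
Qed.

Lemma cost_shift x th v w :
  cost x th (cons_seq v w) =
  qform (costQ mpc) x + qform (costR mpc) (offset th ord0N) +
  pcost N.-1 (A *m x + B *m offset th ord0N + G *m v) (shift th v) w.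
Proof.
rewrite -pcostN /pcost (eq_bigl xpredT); last by move=> i; rewrite ltn_ord.
have h0 := horizon_gt0 mpc.
rewrite state_shift ?prednK// addrA; congr (_ + _).
rewrite (big_ord_shift _ (horizon_gt0 mpc)); congr (_ + _).
  by rewrite /stage inputE big1 ?addr0//= => j _; rewrite /cgain ltn0 mul0mx.
rewrite [RHS]big_mkcond; apply: eq_bigr => i _.
case: insubP => [i' iN iE|iN]; last by rewrite ifF//; apply/negbTE; lia.
rewrite ifT; last by lia.
rewrite /stage state_shift; last by lia.
by rewrite (@input_shift _ _ _ _ i')// -iE.
Qed.

Lemma admissible_shift x th v w : admissible x th -> distW mpc v ->
  (forall i, distW mpc (w i)) ->
  (forall i : 'I_N, (i < N.-1)%N -> consZ mpc
     (state (A *m x + B *m offset th ord0N + G *m v) (shift th v) w i,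
      input (shift th v) w i)).
Proof.
move=> [_ adm] Wv Ww i iN; rewrite state_shift//.
have i'N : (i.+1 < N)%N by lia.
rewrite (@input_shift _ _ _ _ (Ordinal i'N))//.
have Wc j : distW mpc (cons_seq v w j).
  rewrite /cons_seq; case: j => -[|j]//= jN; case: insubP => [//|].
  by rewrite (ltnW jN).
exact: (adm _ Wc).1 (Ordinal i'N).
Qed.

End dynamics.

(** * Expected cost of a policy *)

Section expected_cost.
Context {R : realType} {n m q : nat} (mpc : mpc_problem R n m q).
Local Notation N := (horizon mpc).
Local Notation A := (dynA mpc).
Local Notation B := (dynB mpc).
Local Notation G := (dynG mpc).
Context {d : R * 'M[R]_q}.
Hypotheses (Wclosed : closed (distW mpc)) (Wbounded : bounded_set (distW mpc)).
Variable P : probability (seqV R q 'I_N) R.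
Hypothesis PW : ambiguity_laws (distW mpc) d P.

Definition noise_form (p : nat) (S : 'M[R]_p) (L : 'I_N -> 'M[R]_(p, q)) : R :=
  \sum_j \tr ((L j)^T *m S *m L j *m covmx P j).

(** The expected cost, from the initial state 0, of the policy with gains M and
    zero offsets. *)
Definition noise_cost (M : 'I_N -> 'I_N -> 'M[R]_(m, q)) : R :=
  \sum_(k < N) (noise_form (costQ mpc) (resp M k) +
                noise_form (costR mpc) (cgain M k)) +
  noise_form (costP mpc) (resp M N).

Lemma has_mean_state x th k (S : 'M[R]_n) :
  has_mean P (fun w => qform S (state (mpc := mpc) x th w k))
    (qform S (state x th (fun=> 0) k) + noise_form S (resp (gain th) k)).
Proof.
apply: has_mean_eq (erefl _) (has_mean_qform_affine Wclosed Wbounded PW S _ _).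
by move=> w; rewrite [in RHS]state_affine.
Qed.

Lemma has_mean_input th i (S : 'M[R]_m) :
  has_mean P (fun w => qform S (input (mpc := mpc) th w i))
    (qform S (input th (fun=> 0) i) + noise_form S (cgain (gain th) i)).
Proof.
apply: has_mean_eq (erefl _) (has_mean_qform_affine Wclosed Wbounded PW S _ _).
by move=> w; rewrite [in RHS]input_affine.
Qed.

Lemma has_mean_stage x th (i : 'I_N) :
  has_mean P (fun w => stage (mpc := mpc) x th w i)
    ((qform (costQ mpc) (state x th (fun=> 0) i) + noise_form (costQ mpc)
      (resp (gain th) i)) +
     (qform (costR mpc) (input th (fun=> 0) i) + noise_form (costR mpc)
       (cgain (gain th) i))).
Proof. by apply: has_meanD; [exact: has_mean_state|exact: has_mean_input]. Qed.

Lemma has_mean_cost x th :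
  has_mean P (cost (mpc := mpc) x th) (cost x th (fun=> 0) + noise_cost
    (gain th)).
Proof.
apply: has_mean_eq _ _
  (has_meanD (has_mean_sum (fun i => has_mean_stage x th i))
  (has_mean_state x th N (costP mpc))); first by [].
rewrite /cost /noise_cost [RHS]addrACA; congr (_ + _).
by rewrite -big_split/=; apply: eq_bigr => i _; exact: addrACA.
Qed.

Lemma has_mean_pcost s x th : exists a, has_mean P (pcost (mpc := mpc) s x th)
    a.
Proof.
pose c (i : 'I_N) : R := (i < s)%N%:R.
have H :=
  has_meanD (has_mean_sum (fun i => has_meanZ (c i) (has_mean_stage x th i)))
  (has_mean_state x th s (costP mpc)).
eexists; apply: has_mean_eq _ (erefl _) H => w.
rewrite /pcost [in RHS]big_mkcond/=; congr (_ + _); apply: eq_bigr => i _.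
by rewrite /c; case: ifP; rewrite ?mul1r ?mul0r.
Qed.

Lemma has_mean_uniq f a b : has_mean P f a -> has_mean P f b -> a = b.
Proof. by move=> [_ fa] [_]; rewrite fa => -[]. Qed.

Section terminal_feedback.
Variables (Kf : 'M[R]_(m, n)) (sigma : R).
Local Notation AK := (A + B *m Kf).
Hypothesis terminal_psd : psd (costP mpc - costQ mpc - Kf^T *m costR mpc *m Kf -
  AK^T *m costP mpc *m AK).
Hypothesis sigmaP : forall j, \tr (G^T *m costP mpc *m G *m covmx P j) <= sigma.

(** The state x(i) is a function of the disturbances before time i, hence
    uncorrelated with w(i). So w(i) raises the mean of the terminal cost by
    exactly the trace term, and the matrix inequality pays for the stage
    cost. *)
Lemma terminal_step s y th (i : 'I_N) : (s <= i)%N ->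
  exists2 e, has_mean P (fun w =>
      stage y (switch Kf s y th) w i +
      (qform (costP mpc) (state y (switch Kf s y th) w i.+1) -
       qform (costP mpc) (state y (switch Kf s y th) w i))) e & e <= sigma.
Proof.
move=> si; set th' := switch Kf s y th.
pose z := state y th' (fun=> 0) i; pose S := resp (gain th') i.
have xE w : state y th' w i = z + \sum_j S j *m w j by exact: state_affine.
have uE w : input th' w i = Kf *m state y th' w i by exact: input_switch_ge.
pose C := costP mpc.
have hP := has_mean_state y th' i C.
have hQ := has_mean_state y th' i (costQ mpc).
have hR := has_mean_state y th' i (Kf^T *m costR mpc *m Kf).
pose vA := qform C (AK *m z) + noise_form C (fun j => AK *m S j).
have hA : has_mean P (fun w => qform C (AK *m state y th' w i)) vA.
  apply: has_mean_eq (erefl _) (has_mean_qform_affine Wclosed Wbounded PW C _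
    _).
  move=> w /=; rewrite xE mulmxDr mulmx_sumr; congr (qform _ (_ + _)).
  by apply: eq_bigr => j _; rewrite mulmxA.
pose S' j := AK *m S j + (if i == j then G else 0).
have hN : has_mean P (fun w => qform C (state y th' w i.+1))
    (qform C (AK *m z) + noise_form C S').
  apply: has_mean_eq (erefl _) (has_mean_qform_affine Wclosed Wbounded PW C _
    _).
  move=> w /=; rewrite valK uE mulmxA -mulmxDl xE mulmxDr mulmx_sumr -addrA.
  congr (qform _ (_ + _)); under eq_bigr do rewrite mulmxDl -mulmxA.
  rewrite big_split/=; congr (_ + _).
  rewrite (bigD1 i)//= eqxx big1 ?addr0// => j /negPf.
  by rewrite eq_sym => ->; rewrite mul0mx.
have vN : noise_form C S' = noise_form C (fun j => AK *m S j) +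
    \tr (G^T *m C *m G *m covmx P i).
  rewrite /noise_form (bigD1 i)//= [in RHS](bigD1 i)//=.
  have Si0 : S i = 0 by exact: resp_causal.
  rewrite /S' eqxx Si0 mulmx0 add0r.
  rewrite trmx0 !mul0mx mxtrace0 add0r addrC; congr (_ + _).
  apply: eq_bigr => j /negPf; rewrite eq_sym => ->; by rewrite addr0.
have hsum := has_meanD (has_meanD hQ hR) (has_meanD hN (has_meanZ (-1) hP)).
eexists.
  apply: has_mean_eq _ (erefl _) hsum => w.
  by rewrite /stage uE -qform_congr mulN1r.
apply: le_trans (sigmaP i); rewrite vN.
have hD := has_meanD hP (has_meanZ (-1) (has_meanD (has_meanD hQ hR) hA)).
have D0 := has_mean_ge0 _ hD; rewrite /vA in D0; rewrite -/C.
suff : forall w, 0 <= qform C (state y th' w i) + -1 *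
    (qform (costQ mpc) (state y th' w i) +
     qform (Kf^T *m costR mpc *m Kf) (state y th' w i) +
     qform C (AK *m state y th' w i)) by move=> /D0; lra.
move=> w; have := terminal_psd.2 (state y th' w i).
rewrite !qformD !qformN (qform_congr _ AK) -/C; lra.
Qed.

(** [terminal_step] telescopes over the N - s steps under the feedback. *)
Lemma switch_cost_le s y th b : (s <= N)%N -> has_mean P (pcost s y th) b ->
  cost y (switch Kf s y th) (fun=> 0) + noise_cost (gain (switch Kf s y th)) <=
  b + (N - s)%:R * sigma.
Proof.
move=> sN hb; set th' := switch Kf s y th.
have H k : (s + k <= N)%N ->
    exists2 a, has_mean P (pcost (s + k) y th') a & a <= b + k%:R * sigma.
  elim: k => [_|k IH skN].
    exists b; last by rewrite mul0r addr0.
    rewrite addn0; apply: has_mean_eq (erefl _) hb => w.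
    by rewrite pcost_switch.
  have skN' : (s + k < N)%N by rewrite -addnS.
  have [a ha ab] := IH (ltnW skN').
  have [e he es] := @terminal_step s y th (Ordinal skN') (leq_addr _ _).
  exists (a + e); last by rewrite -natr1 mulrDl mul1r; lra.
  apply: has_mean_eq (erefl _) (has_meanD ha he) => w.
  by rewrite addnS -[(s + k)%N in RHS]/(val (Ordinal skN')) pcostS -!addrA.
have [|a ha ab] := H (N - s)%N; first by rewrite subnKC.
suff -> : cost y th' (fun=> 0) + noise_cost (gain th') = a by [].
apply: has_mean_uniq (has_mean_cost _ _) _.
apply: has_mean_eq (erefl _) ha => w; by rewrite subnKC// pcostN.
Qed.

End terminal_feedback.
End expected_cost.

(** * Construction of disturbance laws *)

Section law_constructions.
Context {R : realType} {q : nat} {W : set 'cV[R]_q} {d : R * 'M[R]_q}.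
Hypothesis Wclosed : closed W.

Lemma ambiguity_set_ext (mu nu : probability (borelV R q) R) :
  (forall A, measurable A -> mu A = nu A) ->
  ambiguity_set W d mu -> ambiguity_set W d nu.
Proof.
move=> mn.
have E f : ('E_mu[f] = 'E_nu[f])%E.
  by rewrite unlock; apply: eq_measure_integral => A mA _; exact: mn.
have S : second_moment mu = second_moment nu.
  by apply/matrixP => i j; rewrite !mxE E.
move=> [[muW mu0] muB]; split; last by rewrite -S.
split; first by rewrite -mn//; exact: closed_measurableV.
by move=> i; rewrite -E.
Qed.

(** Coordinates outside s are left free by the choice of the whole space for
    their sets. *)
Lemma independent_coords_fin (I : finType) (P : probability (seqV R q I) R) :
  (forall B : I -> set (borelV R q), (forall i, measurable (B i)) ->
    P (\bigcap_i (coord i @^-1` B i)) = (\prod_i P (coord i @^-1` B i))%E) ->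
  independent_coords P.
Proof.
move=> HP s B us mB.
have := HP (fun i => if i \in s then B i else setT) _.
rewrite (_ : \bigcap_i _ = \bigcap_(i in [set` s]) (coord i @^-1` B i));
  last first.
  apply/seteqP; split => w Bw i /=; last by case: ifPn => // si _; exact: Bw.
  by move=> si; have := Bw i Logic.I; rewrite /= si.
move=> ->; last by move=> i; case: ifP.
rewrite (bigID (mem s))/= [X in (_ * X)%E]big1 ?mule1; last first.
  by move=> i /negPf ->; rewrite preimage_setT probability_setT.
rewrite big_uniq//=; apply: eq_big => // i ->; by [].
Qed.

Section restriction.
Variable N : nat.

Definition restrict (w : seqV R q nat) : seqV R q 'I_N := fun i => w i.

Lemma measurable_restrict_seq : measurable_fun setT restrict.
Proof. by apply: measurable_seqV => i; exact: (measurable_coord (i : nat)). Qed.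

Lemma ambiguity_laws_restrict (P : probability (seqV R q nat) R) :
  ambiguity_laws W d P ->
  ambiguity_laws W d (distribution P (mfun_of measurable_restrict_seq)).
Proof.
move=> [Pind PW]; split; last first.
  by move=> i; apply: ambiguity_set_ext (PW i).
apply: independent_coords_fin => B mB.
pose B' (k : nat) : set (borelV R q) := if insub k is Some i then B i else setT.
have mB' k : measurable (B' k) by rewrite /B'; case: insubP.
have BE (i : 'I_N) : B' i = B i by rewrite /B' valK.
have := Pind (index_iota 0 N) B' (iota_uniq _ _) mB'.
rewrite big_mkord => H;
  transitivity (P (\bigcap_(k in [set` index_iota 0 N]) (coord k @^-1` B' k))).
  congr (P _); apply/seteqP; split => w Bw k /=.
    by move=> _; rewrite /B'; case: insubP => // i _ <-; exact: Bw.
  by move=> _; have := Bw k; rewrite /= mem_index_iota ltn_ord BE; apply.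
by rewrite H; apply: eq_bigr => i _; rewrite BE.
Qed.

End restriction.

Section prepending.
Variables (n m : nat) (mpc : mpc_problem R n m q).
Local Notation N := (horizon mpc).
Local Notation ord0N := (Ordinal (horizon_gt0 mpc)).
Variables (mu : probability (borelV R q) R) (P : probability (seqV R q 'I_N) R).

Definition prepend (vw : borelV R q * seqV R q 'I_N) : seqV R q 'I_N :=
  cons_seq vw.1 vw.2.

Lemma measurable_prepend : measurable_fun setT prepend.
Proof.
apply: measurable_seqV => -[[|k] kN]; rewrite /prepend /cons_seq/=.
  exact: measurable_fst.
rewrite insubT/=; first exact: ltnW.
by move=> kN'; exact:
  (measurableT_comp (measurable_coord (Sub k kN')) measurable_snd).
Qed.

(** The law of (v, w(0), ..., w(N-2)), with v of law mu independent of w. *)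
Definition prepend_law : probability (seqV R q 'I_N) R :=
  distribution (mu \x P)%E (mfun_of measurable_prepend).

Lemma coord_prependS v w (i j : 'I_N) : i = j.+1 :> nat ->
  coord i (prepend (v, w)) = coord j w.
Proof. by move=> ij; exact: cons_seqS. Qed.

Lemma prepend_marginal0 B : measurable B ->
  prepend_law (coord ord0N @^-1` B) = mu B.
Proof.
move=> mB; rewrite /prepend_law/= /distribution /pushforward/=.
rewrite [X in (_ \x _)%E X](_ : _ = B `*` setT); last first.
  by apply/seteqP; split => -[v w] //= [].
by rewrite product_measure1E//= probability_setT mule1.
Qed.

Lemma prepend_marginalS (i j : 'I_N) B : i = j.+1 :> nat -> measurable B ->
  prepend_law (coord i @^-1` B) = P (coord j @^-1` B).
Proof.
move=> ij mB; rewrite /prepend_law/= /distribution /pushforward/=.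
rewrite [X in (_ \x _)%E X](_ : _ = setT `*` coord j @^-1` B); last first.
  by apply/seteqP; split => -[v w] /=; rewrite (coord_prependS _ _ ij)// => -[].
rewrite product_measure1E//= ?probability_setT ?mul1e//.
by rewrite -[X in measurable X]setTI; exact: measurable_coord.
Qed.

Hypotheses (muW : ambiguity_set W d mu) (PW : ambiguity_laws W d P).

(** An event that restricts each coordinate is the product of an event on v and
    one on w, so its probability factors. *)
Lemma ambiguity_laws_prepend : ambiguity_laws W d prepend_law.
Proof.
split; last first.
  case=> -[|k] kN.
    apply: ambiguity_set_ext muW => A mA.
    by rewrite -prepend_marginal0//; congr (prepend_law (coord _ @^-1` _));
      exact: val_inj.
  apply: ambiguity_set_ext (PW.2 (Ordinal (ltnW kN))) => A mA.
  exact: (esym (@prepend_marginalS (Ordinal kN) (Ordinal (ltnW kN)) A erefl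
    mA)).
apply: independent_coords_fin => B mB.
pose B' (j : 'I_N) := if insub j.+1 is Some i then B i else setT.
have mB' j : measurable (B' j) by rewrite /B'; case: insubP.
rewrite (big_ord_shift _ (horizon_gt0 mpc)) prepend_marginal0//.
rewrite (_ : \big[_/_]_j _ = \prod_j P (coord j @^-1` B' j))%E; last first.
  apply: eq_bigr => j _; rewrite /B'; case: insubP => [i _ iE|_].
    by rewrite (prepend_marginalS iE).
  by rewrite preimage_setT probability_setT.
have := PW.1 (index_enum _) B' (index_enum_uniq _) mB'.
rewrite /= => <-.
rewrite /prepend_law/= /distribution /pushforward/=.
rewrite [X in (_ \x _)%E X](_ : _ = B ord0N `*`
  \bigcap_(j in [set` index_enum 'I_N]) (coord j @^-1` B' j)).
  rewrite product_measure1E//.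
  apply: fin_bigcap_measurable; first exact: finite_finset.
  by move=> j _; rewrite -[X in measurable X]setTI; exact: measurable_coord.
apply/seteqP; split => -[v w] /=.
  move=> Bvw; split; first exact: (Bvw ord0N I).
  move=> j _ /=; rewrite /B'; case: insubP => // i _ iE.
  by rewrite -(coord_prependS v w iE); exact: Bvw.
move=> [Bv Bw] [[|k] kN] _ /=.
  by rewrite (_ : Ordinal kN = ord0N)//; exact: val_inj.
rewrite (@coord_prependS _ _ _ (Ordinal (ltnW kN)))//.
by have := Bw (Ordinal (ltnW kN)); rewrite /B' /= mem_index_enum insubT; apply.
Qed.

Lemma integral_prepend (f : seqV R q 'I_N -> \bar R) :
  measurable_fun setT f -> (forall w, 0 <= f w)%E ->
  (\int[prepend_law]_w f w = \int[mu]_v \int[P]_w f (cons_seq v w))%E.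
Proof.
move=> mf f0; rewrite ge0_integral_distribution//.
have mfp : measurable_fun setT (f \o prepend).
  exact: (measurableT_comp mf measurable_prepend).
exact: (fubini_tonelli1 (f \o prepend) mfp (fun vw => f0 _)).
Qed.

End prepending.
End law_constructions.

(** * The value function and its expected decrease *)

Section value_function.
Context {R : realType} {n m q : nat} (mpc : mpc_problem R n m q).
Local Notation N := (horizon mpc).
Local Notation A := (dynA mpc).
Local Notation B := (dynB mpc).
Local Notation G := (dynG mpc).
Local Notation W := (distW mpc).
Local Notation ord0N := (Ordinal (horizon_gt0 mpc)).
Variable d : R * 'M[R]_q.
Local Notation laws := (@ambiguity_laws R q 'I_N W d).
Hypotheses (Wclosed : closed W) (Wbounded : bounded_set W).
Hypotheses (Qpsd : psd (costQ mpc)) (Rpsd : psd (costR mpc)) (Ppsd :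
    psd (costP mpc)).

(** Its value is +oo off the feasible set, where the infimum is over the empty
    set; bounds from below then hold on the whole space. *)
Definition value (x : 'cV[R]_n) : \bar R :=
  ereal_inf [set worst_cost d x th | th in admissible (mpc := mpc) x].

Lemma stage_ge0 x th w i : 0 <= stage (mpc := mpc) x th w i.
Proof. by rewrite addr_ge0// ?Qpsd.2 ?Rpsd.2. Qed.

Lemma cost_ge0 x th w : 0 <= cost (mpc := mpc) x th w.
Proof. by rewrite addr_ge0 ?Ppsd.2// sumr_ge0// => i _; exact: stage_ge0. Qed.

Lemma expected_cost (P : probability (seqV R q 'I_N) R) x th : laws P ->
  ('E_P[cost (mpc := mpc) x th] =
   (cost x th (fun=> 0) + noise_cost P (gain th))%:E)%E.
Proof.
by move=> PW; have [_] := has_mean_cost Wclosed Wbounded PW x th;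
  rewrite unlock.
Qed.

Lemma noise_cost_ge0 (P : probability (seqV R q 'I_N) R) M : laws P ->
  0 <= noise_cost (mpc := mpc) P M.
Proof.
move=> PW; pose th : policy mpc := Policy M (fun=> 0).
have := has_mean_ge0 (fun w : seqV R q 'I_N => cost_ge0 0 th w)
  (has_mean_cost Wclosed Wbounded PW 0 th).
have s0 k : state 0 th (fun=> 0) k = 0.
  elim: k => [//|k IH] /=; case: insubP => // i _ _.
  by rewrite IH input0 !mulmx0 !addr0.
rewrite /cost s0 [X in X + _ + _]big1 => [|i _].
  by rewrite add0r /qform mulmx0 mxE add0r.
by rewrite s0 input0 /qform !mulmx0 !mxE addr0.
Qed.

Definition worst_noise (M : 'I_N -> 'I_N -> 'M[R]_(m, q)) : \bar R :=
  ereal_sup [set (noise_cost (mpc := mpc) P M)%:E | P in laws].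

(** The laws only enter the disturbance part of the expected cost. *)
Lemma worst_cost_le x th :
  (worst_cost (mpc := mpc) d x th <=
   (cost x th (fun=> 0))%:E + worst_noise (gain th))%E.
Proof.
apply: ub_ereal_sup => _ [P PW <-]; rewrite expected_cost// EFinD leeD2l//.
by apply: ereal_sup_ubound; exists P.
Qed.

Lemma value_le x th : admissible (mpc := mpc) x th ->
  (value x <= worst_cost d x th)%E.
Proof. by move=> adm; apply: ereal_inf_lbound; exists th. Qed.

Lemma measurable_cost x th : measurable_fun setT
  (fun w : seqV R q 'I_N => (cost (mpc := mpc) x th w)%:E).
Proof.
apply/measurable_EFinP; rewrite /cost.
have mx k : measurable_fun setT (fun w : seqV R q 'I_N => state x th w k :
  borelV R n).
  have -> : (fun w : seqV R q 'I_N => state x th w k : borelV R n) =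
      (fun w => state x th (fun=> 0) k + \sum_j resp (gain th) k j *m w j).
    by apply/funext => w; exact: state_affine.
  apply: measurable_addV; first exact: measurable_cst.
  apply: measurable_sumV => j; apply: measurable_mulmxV; exact:
    (measurable_coord j).
have mu' i : measurable_fun setT (fun w : seqV R q 'I_N => input th w i :
  borelV R m).
  have -> : (fun w : seqV R q 'I_N => input th w i : borelV R m) =
      (fun w => input th (fun=> 0) i + \sum_j cgain (gain th) i j *m w j).
    by apply/funext => w; exact: input_affine.
  apply: measurable_addV; first exact: measurable_cst.
  apply: measurable_sumV => j; apply: measurable_mulmxV; exact:
    (measurable_coord j).
apply: measurable_funD; last exact: measurable_qform.
by apply: measurable_sum => i; apply: measurable_funD; exact: measurable_qform.
Qed.

Lemma worst_cost_ge x th : laws !=set0 ->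
  ((qform (costQ mpc) x)%:E <= worst_cost (mpc := mpc) d x th)%E.
Proof.
move=> [P PW]; apply: le_trans (ereal_sup_ubound _); last by exists P.
rewrite expected_cost// lee_fin ler_wpDr ?noise_cost_ge0//.
rewrite /cost (bigD1 ord0N)//= -!addrA lerDl.
rewrite !addr_ge0 ?Rpsd.2 ?Ppsd.2// sumr_ge0// => i _.
exact: (stage_ge0 x th (fun=> 0) i).
Qed.

Lemma value_ge x : laws !=set0 -> ((qform (costQ mpc) x)%:E <= value x)%E.
Proof. by move=> PW; apply: le_ereal_inf_tmp => _ [th' _ <-]; exact:
  worst_cost_ge. Qed.

Lemma value_ge0 x : laws !=set0 -> (0 <= value x)%E.
Proof. by move=> PW; apply: le_trans (value_ge x PW);
  rewrite lee_fin Qpsd.2. Qed.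

Section descent.
Variables (Kf : 'M[R]_(m, n)) (sigma : R).
Local Notation AK := (A + B *m Kf).
Hypothesis terminal_psd : psd (costP mpc - costQ mpc - Kf^T *m costR mpc *m Kf -
  AK^T *m costP mpc *m AK).
Hypothesis KfZ : forall x, termX mpc x -> consZ mpc (x, Kf *m x).
Hypothesis KfX : forall x v, termX mpc x -> W v -> termX mpc (AK *m x + G *m v).
Hypothesis sigmaE : max_trace mpc d = sigma%:E.

Lemma trace_le_max (mu : probability (borelV R q) R) : ambiguity_set W d mu ->
  \tr (G^T *m costP mpc *m G *m second_moment mu) <= sigma.
Proof.
move=> muW; rewrite -lee_fin -sigmaE; apply: ereal_sup_ubound.
by exists (second_moment mu) => //; exact: muW.2.
Qed.

Lemma sigma_ge0 (mu : probability (borelV R q) R) : ambiguity_set W d mu ->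
  0 <= sigma.
Proof.
move=> muW; apply: le_trans (trace_le_max muW).
apply: has_mean_ge0 (law_qform_mean Wclosed Wbounded muW.1 _) => v.
by rewrite (qform_congr _ G) Ppsd.2.
Qed.

(** The bound is the cost of the terminal feedback applied from time 0 on. *)
Lemma value_terminal x : termX mpc x ->
  (value x <= (qform (costP mpc) x + N%:R * sigma)%:E)%E.
Proof.
move=> Xx; pose th0 : policy mpc := Policy (fun _ _ => 0) (fun=> 0).
apply: (@le_trans _ _ (worst_cost d x (switch Kf 0 x th0))).
  apply: value_le; apply: admissible_switch => //.
apply: ub_ereal_sup => _ [P PW <-]; rewrite expected_cost// lee_fin.
have hb : has_mean P (pcost (mpc := mpc) 0 x th0) (qform (costP mpc) x).
  apply: has_mean_eq (erefl _) (has_mean_cst P _) => w.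
  by rewrite /pcost big1// add0r.
have := switch_cost_le Wclosed Wbounded PW terminal_psd _ (leq0n _) hb.
by rewrite subn0; apply => j; apply: trace_le_max; exact: PW.2.
Qed.

Variables (x : 'cV[R]_n) (th : policy mpc) (mu : probability (borelV R q) R).
Hypotheses (adm : admissible x th) (muW : ambiguity_set W d mu).
Hypothesis mvalue : measurable_fun setT (value : borelV R n -> \bar R).
Hypothesis lawsN0 : laws !=set0.

Let succ (v : 'cV[R]_q) := A *m x + B *m offset th ord0N + G *m v.
(** The candidate at the successor state: the tail of th, then one step of the
    terminal feedback. Its gains are those of [cand 0] whatever v is. *)
Let cand (v : 'cV[R]_q) := switch Kf N.-1 (succ v) (shift th v).
Let gcand := gain (cand 0).

Let msucc : measurable_fun setT (fun v : borelV R q => succ v : borelV R n).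
Proof.
apply: measurable_addV; first exact: measurable_cst.
by apply: measurable_mulmxV; exact: measurable_id.
Qed.

Let mshift i : measurable_fun setT (fun v : borelV R q => offset (shift th v) i
    : borelV R m).
Proof.
rewrite /=; case: insubP => [i' _ _|_]; last exact: measurable_cst.
apply: measurable_addV; first exact: measurable_cst.
by apply: measurable_mulmxV; exact: measurable_id.
Qed.

Let mcenter k : measurable_fun setT (fun v : borelV R q =>
  sw_center Kf (succ v) (offset (shift th v)) N.-1 k : borelV R n).
Proof.
elim: k => [|k IH] /=; first exact: msucc.
case: insubP => // i _ _; apply: measurable_addV; first exact:
  measurable_mulmxV.
apply: measurable_mulmxV; case: (k < N.-1)%N; first exact: mshift.
exact: measurable_mulmxV.
Qed.

Let mcost0 : measurable_fun setT (fun v : borelV R q => cost (succ v) (cand v)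
    (fun=> 0)).
Proof.
rewrite /cost; apply: measurable_funD.
  apply: measurable_sum => i; apply: measurable_funD.
    by apply: measurable_qform; under eq_fun do rewrite state_sw0; exact:
      mcenter.
  apply: measurable_qform; under eq_fun do rewrite input0 /=.
  case: (i < N.-1)%N; first exact: mshift.
  by apply: measurable_mulmxV; exact: mcenter.
by apply: measurable_qform; under eq_fun do rewrite state_sw0; exact: mcenter.
Qed.

Let candidate_admissible v : W v -> admissible (succ v) (cand v).
Proof.
have h0 := horizon_gt0 mpc.
move=> Wv; apply: admissible_switch => //; first exact: leq_pred.
move=> w Ww; split.
  by move=> i iN; apply: admissible_shift.
rewrite state_shift ?prednK//.
have Wc j : W (cons_seq v w j).
  rewrite /cons_seq; case: j => -[|j]//= jN; case: insubP => [//|].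
  by rewrite (ltnW jN).
exact: (adm.2 _ Wc).2.
Qed.

(** For fixed v the candidate costs at most what th costs after time 0, plus
    sigma for the additional step. *)
Let candidate_cost_le v (P : probability (seqV R q 'I_N) R) : laws P ->
  ((cost (succ v) (cand v) (fun=> 0))%:E +
     (noise_cost P gcand + qform (costQ mpc) x)%:E <=
   \int[P]_w (cost x th (cons_seq v w))%:E + sigma%:E)%E.
Proof.
have h0 := horizon_gt0 mpc.
move=> PW; have [b hb] := has_mean_pcost Wclosed Wbounded PW N.-1 (succ v)
  (shift th v).
have := switch_cost_le Wclosed Wbounded PW terminal_psd _ (leq_pred N) hb.
have -> : (N - N.-1 = 1)%N by lia.
move=> /(_ sigma (fun j => trace_le_max (PW.2 j))); rewrite mul1r => h1.
have [_ h2] :=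
  has_meanD (has_mean_cst P (qform (costQ mpc) x + qform (costR mpc)
  (offset th ord0N))) hb.
under eq_integral do rewrite cost_shift.
rewrite h2 -!EFinD lee_fin; have := Rpsd.2 (offset th ord0N).
rewrite -/(cand v) in h1; have -> : gcand = gain (cand v) by [].
lra.
Qed.

(** The value at the successor of v is at most h(v) + s, where h(v) is the
    cost of the candidate without disturbances and s the worst disturbance part
    of its cost. As s does not depend on v, the mean over v concerns h only; and
    each law P of the later disturbances, completed by mu, is a law against
    which the worst cost of th has been tested. *)
Lemma value_descent :
  (\int[mu]_v value (A *m x + B *m offset th ord0N + G *m (v : 'cV[R]_q)) +
   (qform (costQ mpc) x)%:E <= worst_cost d x th + sigma%:E)%E.
Proof.
have intP P : laws P ->
  (\int[mu]_v (cost (succ v) (cand v) (fun=> 0))%:E +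
     (noise_cost P gcand + qform (costQ mpc) x)%:E <=
   worst_cost d x th + sigma%:E)%E.
  move=> PW.
  have c0 : 0 <= noise_cost P gcand + qform (costQ mpc) x.
    by rewrite addr_ge0 ?noise_cost_ge0// Qpsd.2.
  have s0 := sigma_ge0 muW.
  have mF : measurable_fun setT (fun v : borelV R q =>
    \int[P]_w (cost x th (cons_seq v w))%:E)%E.
    apply: (@measurable_fun_fubini_tonelli_F _ _ _ _ _ P
      (fun vw => (cost x th (prepend vw))%:E)).
    - have mp := @measurable_prepend R q n m mpc.
      have mfp : measurable_fun setT ((fun w => (cost x th w)%:E) \o prepend
        (mpc := mpc)) := measurableT_comp (measurable_cost x th) mp.
      exact: mfp.
    - by move=> vw; rewrite lee_fin cost_ge0.
  have F0 (v : borelV R q) : (0 <= \int[P]_w (cost x th (cons_seq v w))%:E)%E.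
    by apply: integral_ge0 => w _; rewrite lee_fin cost_ge0.
  have cstE c : (\int[mu]__ (c%:E : \bar R) = c%:E)%E.
    by rewrite integral_cst//= probability_setT mule1.
  apply: (@le_trans _ _ (\int[mu]_v ((\int[P]_w (cost x th (cons_seq v w))%:E) +
    sigma%:E))%E).
    rewrite -[X in (_ + X <= _)%E]cstE -ge0_integralD//; last 2 first.
    - by move=> v _; rewrite lee_fin cost_ge0.
    - exact/measurable_EFinP.
    apply: ge0_le_integral; first exact: measurableT.
    - by move=> v _; rewrite -EFinD lee_fin addr_ge0// cost_ge0.
    - by apply: emeasurable_funD => //; exact/measurable_EFinP.
    - exact: emeasurable_funD.
    - by move=> v _; exact: candidate_cost_le.
  rewrite ge0_integralD// cstE leeD2r//.
  rewrite -(@integral_prepend R q n m mpc mu P (fun w => (cost x th w)%:E)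
    (measurable_cost x th))//.
    apply: ereal_sup_ubound; exists (prepend_law (mpc := mpc) mu P);
      last by rewrite unlock.
    exact: (ambiguity_laws_prepend Wclosed muW PW).
  by move=> w; rewrite lee_fin cost_ge0.
have [Poo|wcfin] := eqVneq (worst_cost d x th) +oo%E;
  first by rewrite Poo addye// leey.
have [r rE] : exists r, worst_cost d x th = r%:E.
  exists (fine (worst_cost d x th)); rewrite fineK// ge0_fin_numE.
    by rewrite lt_neqAle wcfin leey.
  by apply: le_trans (worst_cost_ge x th lawsN0); rewrite lee_fin Qpsd.2.
rewrite rE in intP *; have [P0 PW0] := lawsN0.
set H := (\int[mu]_v (cost (succ v) (cand v) (fun=> 0))%:E)%E in intP.
have H0 : (0 <= H)%E by apply: integral_ge0 => v _; rewrite lee_fin cost_ge0.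
have [h hE] : exists h, H = h%:E.
  exists (fine H); rewrite fineK// ge0_fin_numE//.
  apply: le_lt_trans (ltry (r + sigma)); rewrite EFinD; apply:
    le_trans (intP _ PW0).
  by rewrite leeDl// lee_fin addr_ge0 ?noise_cost_ge0// Qpsd.2.
rewrite hE in intP.
have sle : (worst_noise gcand <= (r + sigma - h - qform (costQ mpc) x)%:E)%E.
  apply: ub_ereal_sup => _ [P PW <-]; have := intP _ PW.
  by rewrite -!EFinD !lee_fin; lra.
have s0 : (0 <= worst_noise gcand)%E.
  apply: le_trans (ereal_sup_ubound _); last by exists P0; [exact: PW0|].
  by rewrite lee_fin noise_cost_ge0.
have [s sE] : exists s, worst_noise gcand = s%:E.
  by exists (fine (worst_noise gcand)); rewrite fineK// ge0_fin_numE//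
    (le_lt_trans sle)// ltry.
rewrite sE in sle s0.
have : (\int[mu]_v value (succ (v : 'cV[R]_q)) <= H + s%:E)%E.
  rewrite (_ : s%:E = \int[mu]__ s%:E)%E; last first.
    by rewrite integral_cst//= probability_setT mule1.
  rewrite -ge0_integralD//; last 2 first.
  - by move=> v _; rewrite lee_fin cost_ge0.
  - exact/measurable_EFinP.
  apply: ae_ge0_le_integral => //.
  - by move=> v _; apply: value_ge0.
  - exact: (measurableT_comp mvalue msucc).
  - by move=> v _; rewrite -EFinD lee_fin addr_ge0// cost_ge0.
  - by apply: emeasurable_funD => //; exact/measurable_EFinP.
  have FF := ae_filter_ringOfSetsType mu.
  apply: filterS (ae_in_support Wclosed muW.1.1) => v Wv _.
  apply: le_trans (value_le (candidate_admissible Wv)) _.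
  by apply: le_trans (worst_cost_le _ _) _; rewrite -sE.
rewrite hE -EFinD => hs; apply: le_trans (leeD2r _ hs) _.
by rewrite -!EFinD lee_fin; move: sle; rewrite lee_fin; lra.
Qed.

End descent.
End value_function.

(** * Semicontinuity of the value function *)

Section policy_limits.
Context {R : realType} {n m q : nat} (mpc : mpc_problem R n m q).
Local Notation N := (horizon mpc).
Context {T : Type} {F : set_system T} {FF : Filter F}.
Variables (y : T -> 'cV[R]_n) (t : T -> policy mpc) (x : 'cV[R]_n) (th :
    policy mpc).
Hypotheses (yx : y s @[s --> F] --> x)
  (gt : forall i j, cgain (gain (t s)) i j @[s --> F] --> cgain (gain th) i j)
  (vt : forall i, offset (t s) i @[s --> F] --> offset th i).

Lemma cvg_input w i : input (t s) w i @[s --> F] --> input th w i.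
Proof.
rewrite inputE; under eq_fun do rewrite inputE.
apply: cvgD; first exact: vt.
by apply: cvg_sum_mx => j; apply: cvg_mulmx; [exact: gt|exact: cvg_cst].
Qed.

Lemma cvg_state w k : state (y s) (t s) w k @[s --> F] --> state x th w k.
Proof.
elim: k => [|k IH] /=; first exact: yx.
case: insubP => [i _ _|_]; last exact: IH.
apply: cvgD; last exact: cvg_cst.
apply: cvgD; apply: cvg_mulmx; try exact: cvg_cst; first exact: IH.
exact: cvg_input.
Qed.

Lemma cvg_cost w : cost (y s) (t s) w @[s --> F] --> cost x th w.
Proof.
apply: cvgD; last by apply: cvg_qform; exact: cvg_state.
apply: cvg_sum_fin => i; apply: cvgD; apply: cvg_qform; last exact: cvg_input.
exact: cvg_state.
Qed.

Lemma cvg_resp k j : resp (gain (t s)) k j @[s --> F] --> resp (gain th) k j.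
Proof.
elim: k => [|k IH] /=; first exact: cvg_cst.
case: insubP => [i _ _|_]; last exact: IH.
apply: cvgD; last exact: cvg_cst.
apply: cvgD; apply: cvg_mulmx; try exact: cvg_cst; first exact: IH.
exact: gt.
Qed.

Lemma cvg_noise_form (P : probability (seqV R q 'I_N) R) (p : nat) (S : 'M[R]_p)
    (L : T -> 'I_N -> 'M[R]_(p, q)) (L0 : 'I_N -> 'M[R]_(p, q)) :
  (forall j, L s j @[s --> F] --> L0 j) ->
  noise_form P S (L s) @[s --> F] --> noise_form P S L0.
Proof.
move=> LL; apply: cvg_sum_fin => j; apply: cvg_mxtrace.
apply: cvg_mulmx; last exact: cvg_cst.
apply: cvg_mulmx; last exact: LL.
apply: cvg_mulmx; last exact: cvg_cst.
by apply: cvg_trmx; exact: LL.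
Qed.

Lemma cvg_noise_cost (P : probability (seqV R q 'I_N) R) :
  noise_cost P (gain (t s)) @[s --> F] --> noise_cost P (gain th).
Proof.
apply: cvgD; last by apply: cvg_noise_form => j; exact: cvg_resp.
apply: cvg_sum_fin => i; apply: cvgD; apply: cvg_noise_form => j; last exact:
  gt.
exact: cvg_resp.
Qed.

End policy_limits.

Section closed_sublevels.
Context {R : realType} {n m q : nat} (mpc : mpc_problem R n m q).
Local Notation N := (horizon mpc).
Local Notation W := (distW mpc).
Hypotheses (Ubounded : bounded_set (inputU mpc)) (W0 : interior W 0).
Hypotheses (Zclosed : closed (consZ mpc)) (Xclosed : closed (termX mpc)).

Lemma admissible_input_bound : exists2 C : R, 0 <= C & forall x th w i,
  admissible (mpc := mpc) x th -> (forall j, W (w j)) -> `|input th w i| <= C.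
Proof.
have [C C0 UC] := bounded_set_norm_le Ubounded.
exists C => // x th w i [_ adm] Ww; apply: UC.
by have := consZ_input ((adm w Ww).1 i).
Qed.

(** The offsets are the inputs at w = 0. A column of a gain block is read off
    from the change of an input when one disturbance becomes r/2 times a basis
    vector, r being the radius of a ball inside the disturbance set. *)
Lemma admissible_bounded : exists C : R, forall x th,
  admissible (mpc := mpc) x th ->
  (forall i, `|offset th i| <= C) /\ (forall i j, `|cgain (gain th) i j| <= C).
Proof.
have [C C0 UC] := admissible_input_bound.
have /nbhs_ballP[r /= r0 rW] := W0.
have W00 : W 0 by apply: rW; exact: ballxx.
exists (C + 4 * C / r) => x th adm.
have vC i : `|offset th i| <= C.
  by rewrite -(input0 th); apply: (UC x) => // j.
have rp : 0 <= 4 * C / r by rewrite divr_ge0 ?mulr_ge0// ltW.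
split=> [i|i j]; first by rewrite (le_trans (vC i))// lerDl.
rewrite ler_wpDl// ?addr_ge0//; apply: norm_le_coord => // a b.
pose w j' : 'cV[R]_q := if j' == j then (r / 2) *: delta_mx b 0 else 0.
have Ww j' : W (w j').
  rewrite /w; case: eqP => // _; apply: rW; rewrite -ball_normE/= sub0r normrN.
  apply: (@le_lt_trans _ _ (r / 2)); last by lra.
  apply: norm_le_coord => [|k l]; first by lra.
  rewrite !mxE normrM ger0_norm; last by lra.
  by rewrite ler_piMr ?divr_ge0// ?(ltW r0)// normr_nat lern1 leq_b1.
have := UC x th w i adm Ww; rewrite inputE (bigD1 j)//= big1 ?addr0; last first.
  by move=> j' /negPf j'j; rewrite /w j'j mulmx0.
rewrite /w eqxx -scalemxAr => uC.
have : `|(r / 2) *: (cgain (gain th) i j *m (delta_mx b 0 : 'cV[R]_q))| <= C +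
  C.
  rewrite -[X in `|X|](addKr (offset th i)) (le_trans (ler_normD _ _))// normrN.
  by rewrite lerD.
rewrite -colE => /(le_trans (coord_le_norm _ a 0)).
rewrite !mxE normrM ger0_norm; last by lra.
rewrite ler_pdivlMr// => h.
have : r / 2 * `|cgain (gain th) i j a b| <= C + C by [].
lra.
Qed.

(** For x in the closure choose suitable policies at nearby points. They are
    bounded, so along an ultrafilter that converges to x they have a limit,
    which suits x. With L empty the set is the feasible set; with L the
    ambiguity laws it is the set where some policy has worst cost at most b. *)
Lemma closed_sublevel (L : set (probability (seqV R q 'I_N) R)) (b : R) :
  closed [set x | exists2 th, admissible (mpc := mpc) x th &
    forall P, L P -> cost x th (fun=> 0) + noise_cost P (gain th) <= b].
Proof.
set S := [set x | _] => x clx.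
(* An ultrafilter that contains S and converges to x. *)
have PF : ProperFilter (within S (nbhs x)).
  have FW : Filter (within S (nbhs x)) by apply: within_filter; exact:
    nbhs_filter.
  apply: Build_ProperFilter_ex => A nA.
  by have [y [Sy Ay]] := clx _ nA; exists y; exact: Ay.
have [F [UF sF]] := ultraFilterLemma PF.
have FS : F S by apply: sF; exact: withinT.
have idF : y @[y --> F] --> x.
  by move=> A nA; apply: sF; apply: filterS nA => y Ay _.
have /choice[t tP] (y : 'cV[R]_n) : exists th, S y -> admissible (mpc := mpc) y
  th /\
    forall P, L P -> cost y th (fun=> 0) + noise_cost P (gain th) <= b.
  have [[th adm thb]|nS] := pselect (S y); first by exists th.
  by exists (Policy (fun _ _ => 0) (fun=> 0)).
have {tP} tP : \forall y \near F, admissible (mpc := mpc) y (t y) /\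
    forall P, L P -> cost y (t y) (fun=> 0) + noise_cost P (gain (t y)) <= b.
  by apply: filterS FS => y /tP.
have [C CP] := admissible_bounded.
have /choice[v vP] (i : 'I_N) : exists u : 'cV[R]_m, offset (t y) i @[y --> F]
  --> u.
  apply: (ultra_cvg_bounded_mx UF (C := C)).
  by apply: filterS tP => y [/CP[vC _] _]; exact: vC.
have /choice[M MP] (ij : 'I_N * 'I_N) : exists u : 'M[R]_(m, q),
    cgain (gain (t y)) ij.1 ij.2 @[y --> F] --> u.
  apply: (ultra_cvg_bounded_mx UF (C := C)).
  by apply: filterS tP => y [/CP[_ MC] _]; exact: MC.
pose th := Policy (mpc := mpc) (cgain (fun i j => M (i, j))) v.
have gt i j : cgain (gain (t y)) i j @[y --> F] --> cgain (gain th) i j.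
  rewrite /th/= /cgain; case: ifP => ij; last exact: cvg_cst.
  by have := MP (i, j); rewrite /cgain/= ij.
have vt i : offset (t y) i @[y --> F] --> offset th i by exact: vP.
exists th; last first.
  move=> P LP.
  have h : cost y (t y) (fun=> 0) + noise_cost P (gain (t y)) @[y --> F] -->
      cost x th (fun=> 0) + noise_cost P (gain th).
    by apply: cvgD; [exact: cvg_cost|exact: cvg_noise_cost].
  have hb : (b : R) @[_ --> F] --> b by exact: cvg_cst.
  have := ler_cvg_to h hb; apply.
  by apply: filterS tP => y [_ /(_ _ LP)].
split; first by move=> i j ij; exact: cgain_causal.
move=> w Ww; split=> [k|].
  have h : (state y (t y) w k, input (t y) w k) @[y --> F] -->
      (state x th w k, input th w k).
    have h1 : state y (t y) w k @[y --> F] --> state x th w k by exact: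
      cvg_state.
    have h2 : input (t y) w k @[y --> F] --> input th w k by exact: cvg_input.
    exact: (cvg_pair h1 h2).
  apply: (closed_cvg (consZ mpc) Zclosed _ _ h).
  by apply: filterS tP => y [[_ /(_ w Ww)[]]].
have h : state y (t y) w N @[y --> F] --> state x th w N by exact: cvg_state.
apply: (closed_cvg (termX mpc) Xclosed _ _ h).
by apply: filterS tP => y [[_ /(_ w Ww)[]]].
Qed.

Lemma closed_feasible : closed (feasible mpc).
Proof.
rewrite (_ : feasible mpc = [set x | exists2 th, admissible (mpc := mpc) x th &
    forall P, (set0 : set (probability (seqV R q 'I_N) R)) P ->
      cost x th (fun=> 0) + noise_cost P (gain th) <= 0]).
  exact: closed_sublevel.
by apply/seteqP; split => x [th adm]; exists th.
Qed.

Section measurable_value.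
Variable d : R * 'M[R]_q.
Hypotheses (Wclosed : closed W) (Wbounded : bounded_set W).

(** The set where V < r is the union over k of the closed sets where some policy
    has worst cost at most r - 1/(k+1). *)
Lemma measurable_value :
  measurable_fun setT (value mpc d : borelV R n -> \bar R).
Proof.
apply: (measurability _ (ErealGenInftyO.measurableE R)).
move=> _ [_ [r ->] <-]; rewrite setTI.
pose C k : set 'cV[R]_n := [set x | exists2 th, admissible (mpc := mpc) x th &
    forall P, ambiguity_laws W d P ->
     cost x th (fun=> 0) + noise_cost P (gain th) <= r - k.+1%:R^-1].
rewrite [X in measurable X](_ : _ = \bigcup_k C k).
  by apply: bigcupT_measurable => k; apply: closed_measurableV; exact:
    closed_sublevel.
apply/seteqP; split => x /=; rewrite in_itv/=.
  move=> /ereal_inf_lt[_ [th adm <-] wr].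
  have wP P : ambiguity_laws W d P ->
      ((cost x th (fun=> 0) + noise_cost P (gain th))%:E <= worst_cost d x
        th)%E.
    move=> PW; rewrite -(expected_cost (d := d) Wclosed Wbounded)//.
    by apply: ereal_sup_ubound; exists P.
  have [k kr] : exists k : nat, (worst_cost d x th <= (r - k.+1%:R^-1)%:E)%E.
    move: wr; case: (worst_cost d x th) => [c|//|_]; last by exists 0%N;
      rewrite leNye.
    rewrite lte_fin => /ltr_add_invr[k ck]; exists k.
    by rewrite lee_fin lerBrDr ltW.
  exists k => //; exists th => // P PW.
  by rewrite -lee_fin (le_trans _ kr)// wP.
move=> [k _ [th adm thr]].
apply: (@le_lt_trans _ _ (r - k.+1%:R^-1)%:E); last first.
  by rewrite lte_fin ltrBlDr ltrDl invr_gt0.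
apply: le_trans (value_le d adm) _; apply: ub_ereal_sup => _ [P PW <-].
by rewrite (expected_cost (d := d) Wclosed Wbounded)// lee_fin thr.
Qed.

End measurable_value.
End closed_sublevels.

(** * The closed loop as a Markov chain *)

Section past.
Context {R : realType} {q : nat}.

(** These cylinders generate the information available at time k, that is, the
    disturbances w(0), ..., w(k-1). *)
Definition past (k : nat) : set (set (nat -> borelV R q)) :=
  [set C | exists2 B : nat -> set (borelV R q), (forall i, measurable (B i)) &
    C = \bigcap_(i in [set` iota 0 k]) (coord i @^-1` B i)].

Lemma past_measurable k (C : set (seqV R q nat)) : past k C -> measurable C.
Proof.
move=> [B mB ->]; apply: fin_bigcap_measurable; first exact: finite_seq.
by move=> i _; rewrite -[X in measurable X]setTI; exact: measurable_coord.
Qed.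

Lemma past_setI k : setI_closed (past k).
Proof.
move=> _ _ [B mB ->] [C mC ->]; exists (fun i => B i `&` C i).
  by move=> i; exact: measurableI.
by rewrite -bigcapI; apply: eq_bigcapr => i _; rewrite preimage_setI.
Qed.

Lemma pastT k : past k setT.
Proof.
by exists (fun=> setT) => //; apply/esym/seteqP; split => // w _ i _.
Qed.

(** Both sides are finite measures in E, and by independence they agree on the
    cylinders of [past k], which are stable under intersection. *)
Lemma past_independent (P : probability (seqV R q nat) R) k
    (E : set (seqV R q nat)) (B : set (borelV R q)) :
  independent_coords P -> <<s past k >> E -> measurable B ->
  P (E `&` coord k @^-1` B) = (P E * P (coord k @^-1` B))%E.
Proof.
move=> ind sE mB.
have mC : measurable (coord k @^-1` B : set (seqV R q nat)).
  by rewrite -[X in measurable X]setTI; exact: measurable_coord.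
set C := coord k @^-1` B in mC *.
pose c : {nonneg R} := NngNum (fine_ge0 (measure_ge0 P C)).
have cE : (c%:num%:E = P C)%E by rewrite /= fineK// fin_num_measure.
rewrite muleC -cE -/(mscale c P E) -/(mrestr P mC E).
apply: (@g_sigma_algebra_measure_unique _ R (seqV R q nat) (past k) _
  (fun=> setT) _ _
  (mrestr P mC : {measure set (seqV R q nat) -> \bar R})
  (mscale c P : {measure set (seqV R q nat) -> \bar R})) => //.
- by move=> A; exact: past_measurable.
- by move=> _; exact: pastT.
- by rewrite bigcup_const.
- exact: past_setI.
- move=> A [D mD ->]; rewrite -[RHS]/(c%:num%:E * P _)%E cE
  -[LHS]/(P (_ `&` C)).
  pose D' i := if i == k then B else D i.
  have mD' i : measurable (D' i) by rewrite /D'; case: ifP.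
  have us : uniq (iota 0 k ++ [:: k]).
    by rewrite cat_uniq iota_uniq/= mem_iota add0n ltnn.
  have := ind (iota 0 k ++ [:: k]) D' us mD'.
  rewrite big_cat/= big_seq1.
  have D'k : D' k = B by rewrite /D' eqxx.
  have kN i : i \in iota 0 k -> (i == k) = false.
    by rewrite mem_iota add0n => /andP[_ ik]; rewrite ltn_eqF.
  rewrite D'k muleC => H.
  rewrite (_ : _ `&` C = \bigcap_(i in [set` iota 0 k ++ [:: k]])
    (coord i @^-1` D' i)).
    rewrite H; congr (_ * _)%E.
    rewrite (ind (iota 0 k) D (iota_uniq _ _) mD).
    by apply: eq_big_seq => i /kN ik; rewrite /D' ik.
  apply/seteqP; split => w.
    move=> [wD wC] i /=; rewrite mem_cat inE => /orP[ik|/eqP ->];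
      last by rewrite D'k.
    by rewrite /D' (kN _ ik); exact: wD.
  move=> wD; split => [i ik|].
    by have := wD i; rewrite /= mem_cat ik/= /D' (kN _ ik); apply.
  by have := wD k; rewrite /= mem_cat inE eqxx orbT D'k; apply.
- move=> _; apply: (@le_lt_trans _ _ 1%E); last exact: ltry.
  by apply: probability_le1; exact: measurableI.
Qed.

End past.

Section closed_loop_chain.
Context {R : realType} {n m q : nat} (mpc : mpc_problem R n m q).
Local Notation N := (horizon mpc).
Local Notation A := (dynA mpc).
Local Notation B := (dynB mpc).
Local Notation G := (dynG mpc).
Local Notation W := (distW mpc).
Variable kap : 'cV[R]_n -> 'cV[R]_m.
Hypothesis mkap : measurable_fun (feasible mpc : set (borelV R n))
  (kap : borelV R n -> borelV R m).
Hypothesis Fclosed : closed (feasible mpc).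

Definition loop_input (x : 'cV[R]_n) : 'cV[R]_m :=
  if x \in feasible mpc then kap x else 0.

Definition loop_map (xw : borelV R n * borelV R q) : borelV R n :=
  A *m (xw.1 : 'cV[R]_n) + B *m loop_input xw.1 + G *m (xw.2 : 'cV[R]_q).

Lemma measurable_loop_input :
  measurable_fun setT (loop_input : borelV R n -> borelV R m).
Proof.
move=> _ C mC; rewrite setTI.
have mF := closed_measurableV Fclosed.
rewrite (_ : _ @^-1` C = ((feasible mpc : set (borelV R n)) `&` (kap :
  borelV R n -> borelV R m) @^-1` C) `|`
   (~` (feasible mpc : set (borelV R n)) `&` [set x | C 0])).
  apply: measurableU; first exact: mkap.
  apply: measurableI; first exact: measurableC.
  have [C0|C0] := pselect (C 0).
    by rewrite (_ : [set x | _] = setT)//; apply/seteqP; split.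
  by rewrite (_ : [set x | _] = set0)//; apply/seteqP; split.
apply/seteqP; split => x /=; rewrite /loop_input.
  by case: ifPn => [/set_mem|/negP Fx]; [left|right; split => // /mem_set].
by case=> [[/mem_set -> //]|[Fx C0]]; rewrite ifN//; apply/negP => /set_mem.
Qed.

Lemma measurable_loop_map : measurable_fun setT loop_map.
Proof.
apply: measurable_addV; last by apply: measurable_mulmxV; exact: measurable_snd.
apply: measurable_addV; apply: measurable_mulmxV; first exact: measurable_fst.
exact: (measurableT_comp measurable_loop_input measurable_fst).
Qed.

Lemma closed_loopS x (w : nat -> 'cV[R]_q) k :
  closed_loop mpc kap x w k.+1 = loop_map (closed_loop mpc kap x w k, w k).
Proof. by []. Qed.

Lemma measurable_closed_loop d (T : measurableType d) (xi :
    T -> nat -> 'cV[R]_q) x k :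
  (forall i, (i < k)%N -> measurable_fun setT (fun t => xi t i : borelV R q)) ->
  measurable_fun setT (fun t => closed_loop mpc kap x (xi t) k : borelV R n).
Proof.
elim: k => [|k IH] mxi; first exact: measurable_cst.
under eq_fun do rewrite closed_loopS.
apply: (measurableT_comp measurable_loop_map); apply: measurable_fun_pair.
  by apply: IH => i ik; apply: mxi; rewrite ltnW.
exact: mxi.
Qed.

(** The recursion up to time k uses the first k disturbances only. *)
Lemma closed_loop_past x k (C : set (borelV R n)) : measurable C ->
  <<s past k >> [set w : seqV R q nat | C (closed_loop mpc kap x w k)].
Proof.
move=> mC.
have := @measurable_closed_loop _
  (g_sigma_algebraType (past (R := R) (q := q) k)) id x k.
move=> /(_ _ measurableT _ mC); rewrite setTI; apply => i ik _ D mD.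
rewrite setTI; apply: sub_sigma_algebra.
exists (fun j => if j == i then D else setT); first by move=> j; case: ifP.
apply/seteqP; split => w /= wD; first by move=> j _ /=; case: eqP => // ->.
by have := wD i; rewrite /= mem_iota add0n ik eqxx; apply.
Qed.

Section contraction.
Variables (d : R * 'M[R]_q) (P : probability (seqV R q nat) R).
Hypotheses (PW : ambiguity_laws W d P).
Variables (V : borelV R n -> \bar R) (a s : R).
Hypotheses (mV : measurable_fun setT V) (V0 : forall x, (0 <= V x)%E).
Hypotheses (a01 : 0 <= a) (s0 : 0 <= s).
Hypothesis drift : forall x mu, ambiguity_set W d mu ->
  (\int[mu]_v V (loop_map (x, v)) <= a%:E * V x + s%:E)%E.

Let X x k : {mfun seqV R q nat >-> borelV R n} :=
  mfun_of (measurable_closed_loop (xi := fun w : seqV R q nat => w) x (k := k)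
    (fun i _ => measurable_coord i)).

(** Since x(k) is independent of w(k), the mean may first be taken over w(k)
    with x(k) frozen, where the drift condition applies. *)
Lemma chain_step x k :
  (\int[P]_w V (closed_loop mpc kap x w k.+1) <=
   a%:E * \int[P]_w V (closed_loop mpc kap x w k) + s%:E)%E.
Proof.
have mX : measurable_fun setT (fun w : seqV R q nat =>
  V (closed_loop mpc kap x w k)).
  exact: (measurableT_comp mV (measurable_funPT (X x k))).
have := @ge0_integral_independent _ _ _ _ _ _ _ P (X x k) (coord k) _
  (V \o loop_map) (measurableT_comp mV measurable_loop_map) (fun z => V0 _).
move=> /= ->; last first.
  move=> C D mC mD; apply: past_independent PW.1 _ mD; exact: closed_loop_past.
rewrite (_ : s%:E = \int[P]__ s%:E)%E; last first.
  by rewrite integral_cst//= probability_setT mule1.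
rewrite -ge0_integralZl//.
rewrite -ge0_integralD//; last 2 first.
- by move=> w _; rewrite mule_ge0// lee_fin.
- exact: measurable_funeM.
apply: ge0_le_integral => //.
- by move=> w _; apply: integral_ge0.
- have mf : measurable_fun setT (V \o loop_map) := measurableT_comp mV
  measurable_loop_map.
  have := @measurable_fun_fubini_tonelli_F _ _ _ _ _ (distribution P (coord k))
    (V \o loop_map) mf (fun z => V0 _).
  move=> h; exact: (measurableT_comp h (measurable_funPT (X x k))).
- by apply: emeasurable_funD => //; exact: measurable_funeM.
- by move=> w _; apply: drift; exact: PW.2.
Qed.

(** The constant c is the fixed point of t |-> a t + s, towards which the
    recursion of [chain_step] contracts. *)
Lemma chain_bound x k b c : V x = b%:E -> s = (1 - a) * c ->
  (\int[P]_w V (closed_loop mpc kap x w k) <= (a ^+ k * (b - c) + c)%:E)%E.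
Proof.
move=> Vx sE; elim: k => [|k IH].
  under eq_integral do rewrite /= Vx.
  by rewrite integral_cst//= probability_setT mule1 lee_fin expr0; lra.
apply: le_trans (chain_step x k) _.
apply: (@le_trans _ _ (a%:E * (a ^+ k * (b - c) + c)%:E + s%:E)%E).
  by rewrite leeD2r// lee_wpmul2l// lee_fin.
by rewrite -EFinM -EFinD lee_fin sE exprS; lra.
Qed.

End contraction.
End closed_loop_chain.

(** * Stability *)

Section bounded_cost.
Context {R : realType} {n m q : nat} (mpc : mpc_problem R n m q).
Local Notation N := (horizon mpc).
Local Notation A := (dynA mpc).
Local Notation B := (dynB mpc).
Local Notation G := (dynG mpc).
Local Notation W := (distW mpc).
Hypotheses (Ubounded : bounded_set (inputU mpc)) (Wbounded : bounded_set W).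
Hypothesis Fbounded : bounded_set (feasible mpc).

Lemma state_bounded k : exists2 D : R, 0 <= D & forall x th w,
  admissible (mpc := mpc) x th -> (forall i, W (w i)) -> `|state x th w k| <= D.
Proof.
have [Cu Cu0 UC] := admissible_input_bound Ubounded.
have [Cw Cw0 WC] := bounded_set_norm_le Wbounded.
have [Cx Cx0 XC] := bounded_set_norm_le Fbounded.
elim: k => [|k [D D0 IH]].
  by exists Cx => // x th w adm _; apply: XC; exists th.
exists (D + (n%:R * `|A| * D + m%:R * `|B| * Cu + q%:R * `|G| * Cw)).
  by rewrite !addr_ge0 ?mulr_ge0.
move=> x th w adm Ww /=; have Dk := IH x th w adm Ww.
case: insubP => [i _ _|_]; last first.
  by rewrite (le_trans Dk)// lerDl !addr_ge0 ?mulr_ge0.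
rewrite ler_wpDl// (le_trans (ler_normD _ _))// lerD//.
  rewrite (le_trans (ler_normD _ _))// lerD// (le_trans (norm_mulmx_le _ _))//.
    by rewrite ler_wpM2l// mulr_ge0.
  by rewrite ler_wpM2l ?mulr_ge0// (UC x).
by rewrite (le_trans (norm_mulmx_le _ _))// ler_wpM2l ?mulr_ge0// WC.
Qed.

Lemma cost_bounded : exists2 C : R, 0 <= C & forall x th w,
  admissible (mpc := mpc) x th -> (forall i, W (w i)) -> cost x th w <= C.
Proof.
have [Cu Cu0 UC] := admissible_input_bound Ubounded.
have /choice[D DP] (k : nat) : exists D : R, 0 <= D /\ forall x th w,
    admissible (mpc := mpc) x th -> (forall i, W (w i)) -> `|state x th w k| <=
      D.
  by have [D D0 HD] := state_bounded k; exists D.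
exists (\sum_(i < N) (n%:R ^+ 2 * `|costQ mpc| * D i ^+ 2 + m%:R ^+ 2 * `|costR
  mpc| * Cu ^+ 2) +
  n%:R ^+ 2 * `|costP mpc| * D N ^+ 2).
  rewrite addr_ge0 ?mulr_ge0 ?exprn_ge0 ?(DP _).1// sumr_ge0// => i _.
  by rewrite addr_ge0 ?mulr_ge0 ?exprn_ge0 ?(DP _).1.
move=> x th w adm Ww; apply: lerD; last exact/qform_bounded/(DP _).2.
apply: ler_sum => i _; apply: lerD; first exact/qform_bounded/(DP _).2.
by apply: qform_bounded; exact: (UC x).
Qed.

Lemma value_bounded : closed W -> psd (costQ mpc) -> psd (costR mpc) ->
    psd (costP mpc) ->
  exists2 C : R, 0 <= C & forall d x, feasible mpc x ->
    (value mpc d x <= C%:E)%E.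
Proof.
move=> Wclosed Qpsd Rpsd Ppsd.
have [C C0 HC] := cost_bounded; exists C => // d x [th adm].
apply: le_trans (value_le d adm) _; apply: ub_ereal_sup => _ [P PW <-].
rewrite unlock (_ : C%:E = \int[P]__ C%:E)%E; last first.
  by rewrite integral_cst//= probability_setT mule1.
apply: ae_ge0_le_integral => //.
- by move=> w _; rewrite lee_fin cost_ge0.
- exact: measurable_cost.
have FF := ae_filter_ringOfSetsType P.
have : {ae P, forall w : seqV R q 'I_N, forall i, W (w i)}.
  by apply: filter_forall => i; exact: (ae_in_support_seq Wclosed PW).
by apply: filterS => w Ww _; rewrite lee_fin HC.
Qed.

End bounded_cost.

Theorem corollary3p3 (R : realType) (n m q : nat) (mpc : mpc_problem R n m q)
  (kappa : R * 'M[R]_q -> 'cV[R]_n -> 'cV[R]_m)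
  (hkappa : forall d, ambiguity_params (distW mpc) d ->
     control_law mpc d (kappa d))
  (hU : [/\ closed (inputU mpc), convex_set (inputU mpc), inputU mpc 0
          & bounded_set (inputU mpc)])
  (hW : [/\ closed (distW mpc), convex_set (distW mpc), bounded_set (distW mpc)
          & interior (distW mpc) 0])
  (hZ : [/\ closed (consZ mpc), convex_set (consZ mpc) & consZ mpc 0])
  (hXf : [/\ closed (termX mpc), convex_set (termX mpc) & termX mpc 0])
  (hQ : psd (costQ mpc)) (hR : psd (costR mpc)) (hP : psd (costP mpc))
  (hterm : exists Kf : 'M[R]_(m, n),
     [/\ psd (costP mpc - costQ mpc - Kf^T *m costR mpc *m Kf -
              (dynA mpc + dynB mpc *m Kf)^T *m costP mpc *m
                (dynA mpc + dynB mpc *m Kf)),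
         interior (termX mpc) 0,
         forall x, termX mpc x -> consZ mpc (x, Kf *m x)
       & forall x w, termX mpc x -> distW mpc w ->
           termX mpc ((dynA mpc + dynB mpc *m Kf) *m x + dynG mpc *m w)])
  (hQpos : pd (costQ mpc))
  (hX : bounded_set (feasible mpc) \/ termX mpc = setT) :
  exists lambda c gamma : R,
    [/\ 0 < lambda < 1, 0 < c, 0 < gamma &
      forall (k : nat) (x : 'cV[R]_n) (d : R * 'M[R]_q)
             (P : probability (seqV R q nat) R),
        feasible mpc x -> ambiguity_params (distW mpc) d ->
        ambiguity_laws (distW mpc) d P ->
        ('E_P[fun w => sqnorm (closed_loop mpc (kappa d) x w k)] <=
           (lambda ^+ k * c * sqnorm x)%:E + gamma%:E * max_trace mpc d)%E].
Proof.
have [_ _ _ Ubounded] := hU; have [Wclosed _ Wbounded W0] := hW.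
have [Zclosed _ _] := hZ; have [Xclosed _ _] := hXf.
have [Kf [terminal_psd Xf0 KfZ KfX]] := hterm.
have [l l0 lP] := pd_ge_sqnorm hQpos.
pose N : R := (horizon mpc)%:R.
have [C [C0 lC CP]] : exists C : R, [/\ 0 < C, l < C & forall d sigma x,
    @ambiguity_laws R q 'I_(horizon mpc) (distW mpc) d !=set0 ->
    max_trace mpc d = sigma%:E -> 0 <= sigma -> feasible mpc x ->
    (value mpc d x <= (C * sqnorm x + N * sigma)%:E)%E].
  (* Outside the terminal set |x| is at least the radius r of a ball around 0
     inside it, so a constant bound Cv is also the bound (Cv / r^2) |x|^2. *)
  have [Cb Cb0 HCb] : exists2 Cb : R, 0 <= Cb & forall d x,
      feasible mpc x -> ~ termX mpc x ->
        (value mpc d x <= (Cb * sqnorm x)%:E)%E.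
    case: hX => [Fbounded|XT]; last by exists 0 => // d x _ []; rewrite XT.
    have [Cv Cv0 HCv] := value_bounded Ubounded Wbounded Fbounded Wclosed hQ hR
      hP.
    have /nbhs_ballP[r /= r0 rX] := Xf0.
    exists (Cv / r ^+ 2) => [|d x Fx nXx]; first by rewrite divr_ge0// sqr_ge0.
    apply: le_trans (HCv d x Fx) _; rewrite lee_fin.
    rewrite mulrAC ler_pdivlMr ?exprn_gt0// ler_wpM2l//.
    apply: le_trans (normsq_le_sqnorm x); rewrite lerXn2r ?nnegrE ?(ltW r0)//.
    rewrite leNgt; apply/negP => xr; apply: nXx; apply: rX.
    by rewrite -ball_normE/= sub0r normrN.
  pose Cp := n%:R ^+ 2 * `|costP mpc|.
  have Cp0 : 0 <= Cp by rewrite mulr_ge0 ?exprn_ge0.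
  exists (Cb + Cp + l + 1); split;
    [lra|lra|move=> d sigma x lawsN0 sigmaE s0 Fx].
  have sq0 := sqnorm_ge0 x.
  have [Xx|nXx] := pselect (termX mpc x).
    apply: le_trans (value_terminal Wclosed Wbounded terminal_psd KfZ KfX sigmaE
      Xx) _.
    rewrite lee_fin lerD2r; apply: le_trans (ler_norm _) _.
    apply: le_trans (qform_le_norm _ _) _; rewrite -/Cp.
    apply: (@le_trans _ _ (Cp * sqnorm x)).
      by rewrite ler_wpM2l// normsq_le_sqnorm.
    by rewrite ler_wpM2r//; lra.
  apply: le_trans (HCb d x Fx nXx) _; rewrite lee_fin ler_wpDr ?mulr_ge0//.
  by rewrite ler_wpM2r//; lra.
(* The decrease l |x|^2 is at least a (V x - N sigma). *)
pose a := l / C.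
have a0 : 0 < a by rewrite divr_gt0.
have a1 : a < 1 by rewrite ltr_pdivrMr// mul1r.
have N0 : 0 <= N by exact: ler0n.
exists (1 - a), (C / l), ((N + (1 + a * N) / a) / l); split.
- by apply/andP; split; lra.
- by rewrite divr_gt0.
- by rewrite divr_gt0// ltr_wpDl// divr_gt0// ltr_pwDl// mulr_ge0// ltW.
move=> k x d P Fx dparams PW.
have [mkap kU kopt] := hkappa d dparams.
set gam := (N + (1 + a * N) / a) / l; have gam0 : 0 < gam.
  by rewrite divr_gt0// ltr_wpDl// divr_gt0// ltr_pwDl// mulr_ge0// ltW.
have lawsN0 : @ambiguity_laws R q 'I_(horizon mpc) (distW mpc) d !=set0.
  by eexists; exact: ambiguity_laws_restrict PW.
have mu0 := PW.2 0%N.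
have mt0 : (0 <= max_trace mpc d)%E.
  apply: le_trans (ereal_sup_ubound _);
    last by exists (second_moment (distribution P (coord 0%N))) => //; exact:
    mu0.2.
  rewrite lee_fin; apply: has_mean_ge0 (law_qform_mean Wclosed Wbounded mu0.1 _)
    => v.
  by rewrite (qform_congr _ (dynG mpc)) hP.2.
have [mtoo|mtfin] := eqVneq (max_trace mpc d) +oo%E.
  by rewrite mtoo gt0_muley ?lte_fin// addey// leey.
have [s sE] : exists s, max_trace mpc d = s%:E.
  exists (fine (max_trace mpc d)); rewrite fineK// ge0_fin_numE//.
  by rewrite lt_neqAle mtfin leey.
rewrite sE lee_fin in mt0; rewrite sE.
have Fclosed := closed_feasible Ubounded W0 Zclosed Xclosed.
have mV := measurable_value Ubounded W0 Zclosed Xclosed d Wclosed Wbounded.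
have V0 y : (0 <= value mpc d y)%E by exact:
  (value_ge0 Wclosed Wbounded hQ hR hP).
have Vl y : ((l * sqnorm y)%:E <= value mpc d y)%E.
  apply: le_trans (value_ge Wclosed Wbounded hQ hR hP y lawsN0);
    by rewrite lee_fin.
have Vreal y : feasible mpc y -> exists2 b, value mpc d y = b%:E &
    l * sqnorm y <= b <= C * sqnorm y + N * s.
  move=> Fy; have := CP d s y lawsN0 sE mt0 Fy; have := Vl y.
  case: (value mpc d y) => [b|//|//]; rewrite !lee_fin => h1 h2.
  by exists b => //; rewrite h1 h2.
have drift y (mu : probability (borelV R q) R) : ambiguity_set (distW mpc) d mu
  ->
    (\int[mu]_v value mpc d (loop_map mpc (kappa d) (y, v)) <=
     (1 - a)%:E * value mpc d y + ((1 + a * N) * s)%:E)%E.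
  move=> muW; have [Fy|nFy] := pselect (feasible mpc y); last first.
    rewrite (_ : value mpc d y = +oo%E).
      by rewrite gt0_muley ?lte_fin ?subr_gt0// addye// leey.
    rewrite /value (_ : [set _ | _ in _] = set0) ?ereal_inf0//.
    by apply/seteqP; split => // z [th adm _]; apply: nFy; exists th.
  have [th [adm opt] kE] := kopt y Fy.
  have := value_descent Wclosed Wbounded hQ hR hP terminal_psd KfZ KfX sE adm
    muW mV lawsN0.
  have -> : worst_cost d y th = value mpc d y.
    apply/eqP; rewrite eq_le value_le// andbT.
    by apply: le_ereal_inf_tmp => _ [th' adm' <-]; exact: opt.
  have lE (v : borelV R q) : loop_map mpc (kappa d) (y, v) = dynA mpc *m y +
      dynB mpc *m offset th (Ordinal (horizon_gt0 mpc)) + dynG mpc *m (v :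
        'cV[R]_q).
    by rewrite /loop_map /loop_input/= mem_set// kE.
  under [in X in _ -> X]eq_integral do rewrite lE.
  have [b bE /andP[lb ub]] := Vreal y Fy; rewrite bE.
  set J := (\int[mu]_v _)%E => h.
  have J0 : (0 <= J)%E by apply: integral_ge0.
  have h' : (J <= (b + s - qform (costQ mpc) y)%:E)%E.
    by rewrite EFinB leeBrDr// EFinD.
  apply: le_trans h' _; rewrite -EFinM -EFinD lee_fin.
  have q1 := lP y; have q2 : a * (C * sqnorm y) <= l * sqnorm y.
    by rewrite mulrA /a divfK ?gt_eqF.
  have q3 : a * b <= a * (C * sqnorm y + N * s) by rewrite ler_wpM2l// ltW.
  have -> : (1 + a * N) * s = s + a * (N * s) by ring.
  by move: q3; rewrite mulrDr; lra.
have [b bE /andP[lb ub]] := Vreal x Fx.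
have a01 : 0 <= 1 - a by lra.
have s0' : 0 <= (1 + a * N) * s by rewrite mulr_ge0// addr_ge0// mulr_ge0// ltW.
(* The recursion t |-> (1 - a) t + (1 + a N) s has fixed point
   ((1 + a N) / a) s. *)
have sc : (1 + a * N) * s = (1 - (1 - a)) * ((1 + a * N) / a * s).
  by field; rewrite gt_eqF.
have := chain_bound mkap Fclosed PW mV V0 a01 s0' drift k bE sc.
set D := (1 + a * N) / a * s => Vk.
have mcl : measurable_fun setT (fun w : seqV R q nat => closed_loop mpc
  (kappa d) x w k : borelV R n).
  exact: (measurable_closed_loop mkap Fclosed (xi := fun w : seqV R q nat => w)
    x (fun i _ => measurable_coord i)).
have : (l%:E * 'E_P[fun w => sqnorm (closed_loop mpc (kappa d) x w k)] <=
    ((1 - a) ^+ k * (b - D) + D)%:E)%E.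
  apply: le_trans Vk; rewrite unlock -ge0_integralZl//; last first.
  - by rewrite lee_fin ltW.
  - by move=> w _; rewrite lee_fin sqnorm_ge0.
  - by apply/measurable_EFinP; exact: measurable_sqnorm.
  apply: ge0_le_integral => //.
  - by move=> w _; rewrite -EFinM lee_fin mulr_ge0 ?sqnorm_ge0// ltW.
  - by apply: measurable_funeM; apply/measurable_EFinP; exact:
    measurable_sqnorm.
  - exact: (measurableT_comp mV mcl).
  - by move=> w _; rewrite -EFinM.
rewrite -lee_pdivlMl// => h; apply: le_trans h _.
rewrite -EFinM -EFinM -EFinD lee_fin ler_pdivrMl//.
have p0 : 0 <= (1 - a) ^+ k by rewrite exprn_ge0.
have p1 : (1 - a) ^+ k <= 1 by rewrite exprn_ile1// gerBl ltW.
have D0 : 0 <= D by rewrite mulr_ge0// divr_ge0 ?ltW// ltr_pwDl// mulr_ge0//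
  ltW.
have -> : l * ((1 - a) ^+ k * (C / l) * sqnorm x + gam * s) =
    (1 - a) ^+ k * (C * sqnorm x) + N * s + D.
  by rewrite /gam /D; field; rewrite !gt_eqF.
have e1 : (1 - a) ^+ k * b <= (1 - a) ^+ k * (C * sqnorm x + N * s) by rewrite
  ler_wpM2l.
have e2 : (1 - a) ^+ k * (N * s) <= 1 * (N * s) by rewrite ler_wpM2r// mulr_ge0.
have e3 : 0 <= (1 - a) ^+ k * D by rewrite mulr_ge0.
by rewrite mulrBr; rewrite mulrDr in e1; lra.
Qed.
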